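(* Let $\mathcal{S}$ be an operator system with unit $e$. Then the following are equivalent: (i) the identity map $\operatorname{id}$ from $\mathcal{S}$ to $\operatorname{OMAX}(\mathcal{S})$ is completely bounded with $\|\operatorname{id}\|_{cb} =C$; (ii) for every operator system $\mathcal{T}$, every unital positive linear map from $\mathcal{S}$ into $\mathcal{T}$ is completely bounded and the supremum of the completely bounded norms of all such maps is $C$; (iii) for every Hilbert space $H$, every unital positive linear map $\phi$ from $\mathcal{S}$ into $B(H)$ decomposes as a difference of two completely positive maps $\phi =\phi_1 - \phi_2$, and $$C = \sup_{\phi} \ \inf\{\|\phi_1(e) + \phi_2(e)\| : \phi = \phi_1 - \phi_2\},$$ where the supremum is taken over all unital positive linear maps $\phi: \mathcal{S}\rightarrow B(H)$ (over all Hilbert spaces $H$) and the infimum over all decompositions of $\phi$ with $\phi_1,\phi_2:\mathcal{S}\to B(H)$ completely positive.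
   Context: An (abstract) operator system is a triple $(V,\{C_n\}_{n\ge1},e)$: $V$ is a complex vector space with conjugate-linear involution $*$ (and $M_n(V)$ has involution $(a_{i,j})^*=(a_{j,i}^* )$); $C_n=M_n(V)^+$ are cones in $M_n(V)_h$ (hermitian elements) with $C_n\cap-C_n=\{0\}$ and $X^*C_nX\subseteq C_m$ for all $X\in M_{n,m}(\mathbb{C})$; and $e\in V_h$ is such that, for each $n$, $e_n=\operatorname{diag}(e,\dots,e)$ is an Archimedean order unit for $(M_n(V),C_n)$ (for each hermitian $A$ there is $r>0$ with $re_n-A\in C_n$; and $re_n+A\in C_n$ for all $r>0$ implies $A\in C_n$). By the Choi–Effros theorem every operator system is unitally completely order isomorphic to a concrete one (a $*$-closed subspace of some $B(H)$ containing $I$), and it thereby carries a canonical operator space structure, namely $\|A\|_{M_n(V)}=\inf\{t>0:\begin{pmatrix} te_n & A \\ A^* & te_n \end{pmatrix}\in C_{2n}\}$. Completely bounded norms are with respect to these matrix norms: $\|\phi\|_{cb}=\sup_n\|\phi_n\|$, $\phi_n((v_{i,j}))=(\phi(v_{i,j}))$. A linear map is positive if it maps the first-level cone into the first-level cone, completely positive if $\phi_n$ maps the $n$-th cone into the $n$-th cone for all $n$, and unital if it maps unit to unit. $\operatorname{OMAX}(\mathcal{S})$ is the operator system with the same underlying $*$-vector space and unit $e$ as $\mathcal{S}$ and cones $C_n^{\max}(\mathcal{S})=\{A\in M_n(\mathcal{S}):re_n+A\in D_n^{\max}(\mathcal{S})\ \forall r>0\}$, where $D_n^{\max}(\mathcal{S})=\{\sum_{i=1}^ka_i\otimes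 v_i:a_i\in M_n^+,v_i\in\mathcal{S}^+,k\in\mathbb{N}\}\subseteq M_n\otimes\mathcal{S}=M_n(\mathcal{S})$ and $\mathcal{S}^+$ is the first-level cone of $\mathcal{S}$. *)

(* Defs.v *)
From HB Require Import structures.
From mathcomp Require Import all_boot all_order all_algebra.
From mathcomp Require Import all_classical all_reals all_analysis.
From mathcomp Require Import complex ring.

Set Implicit Arguments.
Unset Strict Implicit.
Unset Printing Implicit Defensive.

Import Order.TTheory GRing.Theory Num.Theory.
Import numFieldNormedType.Exports.

Local Open Scope classical_set_scope.
Local Open Scope complex_scope.
Local Open Scope sesquilinear_scope.
Local Open Scope ring_scope.

(* The complex scalars are R[i] with R : realType; for z : R[i], 0 <= z means
   that z is real and nonnegative. Matrices over V are the library's 'M[V]_n,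
   and e%:M is diag(e, ..., e) for e : V. *)

Definition psdmx (C : numClosedFieldType) n (a : 'M[C]_n) :=
  forall x : 'rV[C]_n, 0 <= (x *m a *m x ^t Num.conj) 0 0.

Section MatrixSpaces.
Variable R : realType.
Local Notation C := R[i].

(* the data on which positivity, complete positivity and unitality depend *)
Record mspace := MSpace {
  mspace_sort :> lmodType C;
  mcone : forall n, set 'M[mspace_sort]_n;
  munit : mspace_sort
}.

Definition pos (V : mspace) : set V := [set v | mcone (v%:M : 'M[V]_1)].

Definition positive_map (V W : mspace) (phi : {linear V -> W}) :=
  forall v, pos v -> pos (phi v).

Definition completely_positive (V W : mspace) (phi : {linear V -> W}) :=
  forall n (A : 'M[V]_n), mcone A -> mcone (map_mx phi A).

Definition unital_map (V W : mspace) (phi : {linear V -> W}) :=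
  phi (munit V) = munit W.

Definition adjmx (V : lmodType C) (star : V -> V) m n (A : 'M[V]_(m, n)) :
  'M[V]_(n, m) := map_mx star A^T.

(* X^* A X *)
Definition compress (V : lmodType C) n m (X : 'M[C]_(n, m)) (A : 'M[V]_n) :
  'M[V]_m :=
  \matrix_(i, j) \sum_k \sum_l ((X k i)^* * X l j) *: A k l.

(* The levels range over all n : nat; level 0 carries no information, since
   'M_0 is a singleton, contained in its cone. *)
Record opsystem := OpSystem {
  opsystem_mspace :> mspace;
  star : opsystem_mspace -> opsystem_mspace;
  star_conjlinear : forall (a : C) u v,
    star (a *: u + v) = a^* *: star u + star v;
  starK : involutive star;
  mcone_herm : forall n (A : 'M[opsystem_mspace]_n),
    mcone A -> adjmx star A = A;
  mcone0 : forall n, mcone (0 : 'M[opsystem_mspace]_n);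
  mconeD : forall n (A B : 'M[opsystem_mspace]_n),
    mcone A -> mcone B -> mcone (A + B);
  mconeZ : forall n (t : R) (A : 'M[opsystem_mspace]_n),
    0 <= t -> mcone A -> mcone (map_mx (fun v => t%:C *: v) A);
  mcone_proper : forall n (A : 'M[opsystem_mspace]_n),
    mcone A -> mcone (- A) -> A = 0;
  mcone_compress : forall n m (X : 'M[C]_(n, m)) (A : 'M[opsystem_mspace]_n),
    mcone A -> mcone (compress X A);
  munit_herm : star (munit opsystem_mspace) = munit opsystem_mspace;
  munit_order : forall n (A : 'M[opsystem_mspace]_n), adjmx star A = A ->
    exists2 r : R, 0 < r & mcone ((r%:C *: munit opsystem_mspace)%:M - A);
  munit_arch : forall n (A : 'M[opsystem_mspace]_n),
    (forall r : R, 0 < r -> mcone ((r%:C *: munit opsystem_mspace)%:M + A)) ->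
    mcone A
}.

Definition mnorm (V : opsystem) n (A : 'M[V]_n) : R :=
  inf [set t : R | 0 < t /\
    mcone (block_mx (t%:C *: munit V)%:M A
                    (adjmx (@star V) A) (t%:C *: munit V)%:M)].

Definition amp_norm (V W : opsystem) (phi : {linear V -> W}) n : \bar R :=
  ereal_sup [set (mnorm (map_mx phi A))%:E | A in [set A : 'M[V]_n | mnorm A <= 1]].

Definition cb_norm (V W : opsystem) (phi : {linear V -> W}) : \bar R :=
  ereal_sup (range (amp_norm phi)).

Definition completely_bounded (V W : opsystem) (phi : {linear V -> W}) :=
  (cb_norm phi < +oo)%E.

(* a (x) v under M_n (x) V = M_n(V) *)
Definition tensmx (V : lmodType C) n (a : 'M[C]_n) (v : V) : 'M[V]_n :=
  map_mx (fun c => c *: v) a.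

Definition Dmax (S : mspace) n : set 'M[S]_n :=
  [set A | exists (k : nat) (a : 'I_k -> 'M[C]_n) (v : 'I_k -> S),
    [/\ forall i, psdmx (a i), forall i, pos (v i) &
        A = \sum_(i < k) tensmx (a i) (v i)]].

Definition Cmax (S : mspace) n : set 'M[S]_n :=
  [set A | forall r : R, 0 < r -> Dmax ((r%:C *: munit S)%:M + A)].

(* shown below to be the cones of an operator system, OMAX *)
Definition OMAX_mspace (S : mspace) : mspace := MSpace (@Cmax S) (munit S).

End MatrixSpaces.

Section PsdMatrices.
Variable C : numClosedFieldType.

Lemma psdmx_herm n (a : 'M[C]_n) : psdmx a -> a ^t Num.conj = a.
Proof.
move=> pa.
pose q (x y : 'rV[C]_n) := (x *m a *m y ^t Num.conj) 0 0.
have qDl x y z : q (x + y) z = q x z + q y z by rewrite /q !mulmxDl mxE.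
have qDr x y z : q z (x + y) = q z x + q z y.
  by rewrite /q linearD map_mxD mulmxDr mxE.
have qZl c x y : q (c *: x) y = c * q x y by rewrite /q -!scalemxAl mxE.
have qZr c x y : q x (c *: y) = c^* * q x y.
  by rewrite /q linearZ map_mxZ -scalemxAr mxE.
have qr x : (q x x)^* = q x x by apply/CrealP/ger0_real/pa.
have key x y c : c * q x y + c^* * q y x = c^* * (q x y)^* + c * (q y x)^*.
  have E : c * q x y + c^* * q y x =
      q (c *: x + y) (c *: x + y) - c * c^* * q x x - q y y.
    by rewrite qDl !qDr !(qZl, qZr); ring.
  have : (c * q x y + c^* * q y x)^* = c * q x y + c^* * q y x.
    by rewrite E !rmorphB !rmorphM /= conjCK !qr [c^* * c]mulrC.
  by rewrite rmorphD !rmorphM /= conjCK => <-.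
have qh x y : (q y x)^* = q x y.
  have h1 := key x y 1; have h2 := key x y 'i.
  rewrite !rmorph1 !mul1r in h1; rewrite conjCi !mulNr in h2.
  have {}h2 : q x y - q y x = (q y x)^* - (q x y)^*.
    by apply: (mulfI (@neq0Ci C)); rewrite !mulrBr h2 addrC.
  apply: (mulIf (_ : 2%:R != 0)); first by rewrite pnatr_eq0.
  rewrite !mulr_natr !mulr2n.
  have -> : q x y + q x y = (q x y + q y x) + (q x y - q y x).
    by rewrite addrACA subrr addr0.
  by rewrite h1 h2; ring.
apply/matrixP => i j; rewrite !mxE.
have E k l : q (delta_mx 0 k) (delta_mx 0 l) = a k l.
  by rewrite /q trmx_delta map_delta_mx -rowE -colE !mxE.
by rewrite -(E j i) qh E.
Qed.

Lemma psdmx_diag n (d : 'rV[C]_n) : (forall i, 0 <= d 0 i) -> psdmx (diag_mx d).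
Proof.
move=> d0 x; rewrite mul_mx_diag mxE sumr_ge0// => i _.
by rewrite !mxE mulrAC -normCK mulr_ge0// exprn_ge0.
Qed.

Lemma psdmx_congr n m (X : 'M[C]_(n, m)) (a : 'M[C]_n) :
  psdmx a -> psdmx (X ^t Num.conj *m a *m X).
Proof.
move=> pa x; have := pa (x *m X ^t Num.conj).
by rewrite trmx_mul map_mxM trmxCK !mulmxA.
Qed.

Lemma psdmxD n (a b : 'M[C]_n) : psdmx a -> psdmx b -> psdmx (a + b).
Proof. by move=> pa pb x; rewrite mulmxDr mulmxDl mxE addr_ge0. Qed.

Lemma psdmxZ n (t : C) (a : 'M[C]_n) : 0 <= t -> psdmx a -> psdmx (t *: a).
Proof. by move=> t0 pa x; rewrite -scalemxAr -scalemxAl mxE mulr_ge0. Qed.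

Lemma psdmx_scalar n (t : C) : 0 <= t -> psdmx (t%:M : 'M[C]_n).
Proof.
by move=> t0; rewrite -diag_const_mx; apply: psdmx_diag => i; rewrite mxE.
Qed.

Lemma psdmx_shift n (s t : C) (b : 'M[C]_n) :
  0 <= t -> psdmx (s%:M - b) -> psdmx ((s + t)%:M - b).
Proof.
move=> t0 pb; rewrite raddfD/= addrAC; apply: psdmxD => //.
exact: psdmx_scalar.
Qed.

Lemma herm_spectral n (a : 'M[C]_n) : a ^t Num.conj = a ->
  exists (P : 'M[C]_n) (d : 'rV[C]_n),
    [/\ forall i, d 0 i \is Num.real, P ^t Num.conj *m P = 1%:M,
    P *m P ^t Num.conj = 1%:M & a = P ^t Num.conj *m diag_mx d *m P].
Proof.
move=> ha.
have hh : a \is hermsymmx.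
  by apply/is_hermitianmxP; rewrite expr0 scale1r ha.
have Pu := spectral_unitarymx a.
have dr := hermitian_spectral_diag_real hh.
have /hermitian_normalmx /orthomx_spectralP A_eq := hh.
exists (spectralmx a), (spectral_diag a); split.
- by move=> i; exact: (mxOverP dr).
- by rewrite -invmx_unitary// mulVmx// spectral_unit.
- by rewrite -invmx_unitary// mulmxV// spectral_unit.
- by rewrite -invmx_unitary.
Qed.

Lemma herm_bound n (a : 'M[C]_n) : a ^t Num.conj = a ->
  exists2 b : C, 0 < b & psdmx (b%:M - a).
Proof.
move=> /herm_spectral[P [d [dr PP _ aE]]].
exists (1 + \sum_i `|d 0 i|); first by rewrite ltr_pwDl// sumr_ge0.
set b := 1 + _.
have -> : b%:M - a = P ^t Num.conj *m (diag_mx (const_mx b - d)) *m P.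
  rewrite linearB/= diag_const_mx.
  by rewrite mulmxBr mulmxBl -aE mul_mx_scalar -scalemxAl PP scalemx1.
apply/psdmx_congr/psdmx_diag => i; rewrite !mxE subr_ge0.
rewrite ler_wpDl// (le_trans (real_ler_norm _))//.
by rewrite (bigD1 i)//= lerDl sumr_ge0.
Qed.

Lemma psdmx_gram n (a : 'M[C]_n) : psdmx a ->
  exists P : 'M[C]_n, a = P ^t Num.conj *m P.
Proof.
move=> pa; have [P [d [_ PP PP' aE]]] := herm_spectral (psdmx_herm pa).
have d0 i : 0 <= d 0 i.
  have : psdmx (diag_mx d).
    have := @psdmx_congr _ _ (P ^t Num.conj) _ pa.
    by rewrite trmxCK aE !mulmxA PP' mul1mx -mulmxA PP' mulmx1.
  move=> /(_ (delta_mx 0 i)); rewrite trmx_delta map_delta_mx -rowE -colE.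
  by rewrite !mxE eqxx mulr1n.
exists (diag_mx (\row_i sqrtC (d 0 i)) *m P).
rewrite trmx_mul map_mxM tr_diag_mx map_diag_mx !mulmxA -(mulmxA _ (diag_mx _)).
rewrite mulmx_diag {1}aE; congr (_ *m diag_mx _ *m _).
apply/rowP => i; rewrite !mxE /=.
have -> : (sqrtC (d 0 i))^* = sqrtC (d 0 i).
  by apply: conj_Creal; rewrite ger0_real// sqrtC_ge0.
by rewrite -expr2 sqrtCK.
Qed.

Lemma herm_delta n (p q : 'I_n) :
  (delta_mx p q + delta_mx q p : 'M[C]_n) ^t Num.conj =
  delta_mx p q + delta_mx q p.
Proof.
apply/matrixP => i j; rewrite !mxE rmorphD !rmorph_nat addrC.
by rewrite [(j == p) && _]andbC [(j == q) && _]andbC.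
Qed.

Lemma herm_idelta n (p q : 'I_n) :
  (- 'i *: (delta_mx p q - delta_mx q p) : 'M[C]_n) ^t Num.conj =
  - 'i *: (delta_mx p q - delta_mx q p).
Proof.
apply/matrixP => i j; rewrite !mxE rmorphM rmorphB rmorphN !rmorph_nat /= conjCi.
rewrite [(j == p) && _]andbC [(j == q) && _]andbC opprK.
by rewrite -opprB mulrN mulNr.
Qed.

Lemma herm_split (V : lmodType C) (x y : V) :
  x = 8^-1 *: (x + y) + 8^-1 *: (x + y) + (8^-1 *: (x + y) + 8^-1 *: (x + y)) +
    (- 'i *: ((8^-1 * 'i) *: (x - y) + (8^-1 * 'i) *: (x - y)) -
     - 'i *: ((8^-1 * 'i) *: (y - x) + (8^-1 * 'i) *: (y - x))).
Proof.
have E (z : V) : - 'i *: ((8^-1 * 'i) *: z + (8^-1 * 'i) *: z) =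
    8^-1 *: z + 8^-1 *: z.
  by rewrite -scalerDr scalerA mulrCA mulNr -expr2 sqrCi opprK mulr1 scalerDr.
rewrite !E -[y - x]opprB !scalerN -opprD opprK -!mulr2n -!mulrnA -mulrnDl.
rewrite -scalerDr addrACA subrr addr0 -mulr2n -[x *+ 2]scaler_nat.
rewrite -[RHS]scaler_nat !scalerA -[LHS]scale1r; congr (_ *: _).
by field.
Qed.

End PsdMatrices.

Section OmaxIsOpsystem.
Variables (R : realType) (S : opsystem R).
Local Notation C := R[i].
Local Notation e := (munit S).

Lemma starD : {morph @star R S : u v / u + v}.
Proof. by move=> u v; rewrite -[u in LHS]scale1r star_conjlinear rmorph1 scale1r. Qed.

Lemma star0 : star (0 : S) = 0.
Proof. by apply: (addrI (star 0)); rewrite -starD !addr0. Qed.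

Lemma starZ (a : C) (v : S) : star (a *: v) = a^* *: star v.
Proof. by rewrite -[a *: v]addr0 star_conjlinear star0 addr0. Qed.

Lemma starB : {morph @star R S : u v / u - v}.
Proof. by move=> u v; rewrite -scaleN1r starD starZ rmorphN1 scaleN1r. Qed.

Lemma adjmx1 (v : S) : adjmx (@star _ S) (v%:M : 'M[S]_1) = (star v)%:M.
Proof. by apply/matrixP => i j; rewrite !mxE !ord1 eqxx !mulr1n. Qed.

Lemma scalar_mx1_inj (u v : S) : u%:M = v%:M :> 'M[S]_1 -> u = v.
Proof. by move=> /matrixP/(_ 0 0); rewrite !mxE eqxx !mulr1n. Qed.

Lemma pos_herm (v : S) : pos v -> star v = v.
Proof. by move=> /mcone_herm; rewrite adjmx1 => /scalar_mx1_inj. Qed.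

Let scalar_mxD (V : zmodType) n (u v : V) :
  (u + v)%:M = u%:M + v%:M :> 'M[V]_n.
Proof. exact: raddfD. Qed.

Let scalar_mxB (V : zmodType) n (u v : V) :
  (u - v)%:M = u%:M - v%:M :> 'M[V]_n.
Proof. exact: raddfB. Qed.

Lemma posD (u v : S) : pos u -> pos v -> pos (u + v).
Proof. by rewrite /pos/= => pu pv; rewrite scalar_mxD; apply: mconeD. Qed.

Lemma posZ (t : R) (v : S) : 0 <= t -> pos v -> pos (t%:C *: v).
Proof.
rewrite /pos/= => t0 /(mconeZ t0); congr mcone.
by apply/matrixP => i j; rewrite !mxE !ord1 eqxx !mulr1n.
Qed.

Lemma pos_unit : pos e.
Proof.
have [|r r0] := @munit_order _ S 1 0.
  by apply/matrixP => i j; rewrite !mxE star0.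
rewrite subr0 => /(@posZ r^-1 _ _); rewrite invr_ge0 ltW// scalerA => /(_ isT).
by rewrite -rmorphM mulVf ?gt_eqF// scale1r.
Qed.

Lemma herm_pos_bound (v : S) : star v = v ->
  exists2 r : R, 0 < r & pos (r%:C *: e - v).
Proof.
move=> hv; have [|r r0 h] := @munit_order _ S 1 v%:M; first by rewrite adjmx1 hv.
by exists r => //; rewrite /pos/= scalar_mxB.
Qed.

Lemma tensmxDl n (a b : 'M[C]_n) (v : S) :
  tensmx (a + b) v = tensmx a v + tensmx b v.
Proof. by apply/matrixP => i j; rewrite !mxE scalerDl. Qed.

Lemma tensmxDr n (a : 'M[C]_n) (u v : S) :
  tensmx a (u + v) = tensmx a u + tensmx a v.
Proof. by apply/matrixP => i j; rewrite !mxE scalerDr. Qed.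

Lemma tensmxNl n (a : 'M[C]_n) (v : S) : tensmx (- a) v = - tensmx a v.
Proof. by apply/matrixP => i j; rewrite !mxE scaleNr. Qed.

Lemma tensmxNr n (a : 'M[C]_n) (v : S) : tensmx a (- v) = - tensmx a v.
Proof. by apply/matrixP => i j; rewrite !mxE scalerN. Qed.

Lemma tensmxZ n (a : 'M[C]_n) (c : C) (v : S) :
  tensmx a (c *: v) = tensmx (c *: a) v.
Proof. by apply/matrixP => i j; rewrite !mxE scalerA mulrC. Qed.

Lemma tensmx_scalar n (c : C) (v : S) :
  tensmx (c%:M : 'M[C]_n) v = (c *: v)%:M.
Proof. by apply/matrixP => i j; rewrite !mxE; case: (i == j); rewrite ?scale0r. Qed.

Lemma compressD n m (X : 'M[C]_(n, m)) (A B : 'M[S]_n) :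
  compress X (A + B) = compress X A + compress X B.
Proof.
apply/matrixP => i j; rewrite !mxE -big_split; apply: eq_bigr => k _ /=.
by rewrite -big_split; apply: eq_bigr => l _ /=; rewrite !mxE scalerDr.
Qed.

Lemma compress0 n m (X : 'M[C]_(n, m)) : compress X (0 : 'M[S]_n) = 0.
Proof.
apply/matrixP => i j; rewrite !mxE big1// => k _; rewrite big1// => l _.
by rewrite !mxE scaler0.
Qed.

Lemma compress_tens n m (X : 'M[C]_(n, m)) (a : 'M[C]_n) (v : S) :
  compress X (tensmx a v) = tensmx (X ^t Num.conj *m a *m X) v.
Proof.
apply/matrixP => i j; rewrite !mxE scaler_suml exchange_big; apply: eq_bigr.
move=> l _; rewrite !mxE mulr_suml scaler_suml; apply: eq_bigr => k _.
by rewrite !mxE scalerA mulrAC.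
Qed.

Lemma tens_row n (X : 'rV[C]_n) (v : S) :
  compress X v%:M = tensmx (X ^t Num.conj *m X) v.
Proof.
have -> : v%:M = tensmx 1%:M v :> 'M[S]_1 by rewrite tensmx_scalar scale1r.
by rewrite compress_tens mulmx1.
Qed.

Lemma psd_tens_cone n (a : 'M[C]_n) (v : S) :
  psdmx a -> pos v -> mcone (tensmx a v).
Proof.
move=> /psdmx_gram[P ->] pv.
have -> : tensmx (P ^t Num.conj *m P) v =
    \sum_i tensmx ((row i P) ^t Num.conj *m row i P) v.
  apply/matrixP => i j; rewrite summxE !mxE scaler_suml; apply: eq_bigr => k _.
  by rewrite !mxE big_ord1 !mxE.
elim/big_ind: _ => [|A B|i _]; [exact: mcone0|exact: mconeD|].
by rewrite -tens_row; apply: mcone_compress.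
Qed.

Lemma Dmax_cone n (A : 'M[S]_n) : Dmax A -> mcone A.
Proof.
move=> [k [a [v [pa pv ->]]]].
elim/big_ind: _ => [|B D|i _]; [exact: mcone0|exact: mconeD|].
exact: psd_tens_cone.
Qed.

Lemma DmaxD n (A B : 'M[S]_n) : Dmax A -> Dmax B -> Dmax (A + B).
Proof.
move=> [k [a [v [pa pv ->]]]] [l [b [w [pb pw ->]]]].
exists (k + l)%N,
  (fun i : 'I_(k + l) => match fintype.split i with inl j => a j | inr j => b j end),
  (fun i : 'I_(k + l) => match fintype.split i with inl j => v j | inr j => w j end).
split=> [i|i|]; [by case: fintype.split|by case: fintype.split|].
rewrite big_split_ord/=; congr (_ + _); apply: eq_bigr => i _.
  by have /= -> := @unsplitK k l (inl i).
by have /= -> := @unsplitK k l (inr i).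
Qed.

Lemma Dmax_tens n (a : 'M[C]_n) (v : S) : psdmx a -> pos v -> Dmax (tensmx a v).
Proof.
by move=> pa pv; exists 1%N, (fun=> a), (fun=> v); split=> //; rewrite big_ord1.
Qed.

Lemma Dmax0 n : Dmax (0 : 'M[S]_n).
Proof.
exists 0%N, (fun=> 0), (fun=> 0); split; [by case|by case|by rewrite big_ord0].
Qed.

Lemma Dmax_unit n (r : R) : 0 <= r -> Dmax ((r%:C *: e)%:M : 'M[S]_n).
Proof.
move=> r0; rewrite -tensmx_scalar; apply: Dmax_tens pos_unit.
by apply: psdmx_scalar; rewrite ler0c.
Qed.

Lemma Dmax_compress n m (X : 'M[C]_(n, m)) (A : 'M[S]_n) :
  Dmax A -> Dmax (compress X A).
Proof.
move=> [k [a [v [pa pv ->]]]].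
exists k, (fun i => X ^t Num.conj *m a i *m X), v; split=> //.
  by move=> i; apply: psdmx_congr.
rewrite (big_morph _ (compressD X) (compress0 X)).
by apply: eq_bigr => i _; rewrite compress_tens.
Qed.

Lemma DmaxZ n (t : R) (A : 'M[S]_n) : 0 <= t -> Dmax A ->
  Dmax (map_mx (fun v => t%:C *: v) A).
Proof.
move=> t0 [k [a [v [pa pv ->]]]].
exists k, a, (fun i => t%:C *: v i); split=> //.
  by move=> i; apply: posZ.
apply/matrixP => i j; rewrite !(mxE, summxE) scaler_sumr.
by apply: eq_bigr => l _; rewrite !mxE !scalerA mulrC.
Qed.

Lemma Dmax_Cmax n (A : 'M[S]_n) : Dmax A -> Cmax A.
Proof. by move=> DA r r0; apply: DmaxD => //; exact/Dmax_unit/ltW. Qed.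

Lemma Cmax_cone n (A : 'M[S]_n) : Cmax A -> mcone A.
Proof. by move=> CA; apply: munit_arch => r r0; apply/Dmax_cone/CA. Qed.

Lemma Cmax_herm n (A : 'M[S]_n) : Cmax A -> adjmx (@star _ S) A = A.
Proof. by move/Cmax_cone/mcone_herm. Qed.

Lemma Cmax0 n : Cmax (0 : 'M[S]_n).
Proof. exact/Dmax_Cmax/Dmax0. Qed.

Lemma unit_half n (r : R) :
  (r%:C *: e)%:M = ((r / 2)%:C *: e)%:M + ((r / 2)%:C *: e)%:M :> 'M[S]_n.
Proof. by rewrite -scalar_mxD -scalerDl -rmorphD -splitr. Qed.

Lemma CmaxD n (A B : 'M[S]_n) : Cmax A -> Cmax B -> Cmax (A + B).
Proof.
move=> CA CB r r0; have r20 : 0 < r / 2 by rewrite divr_gt0.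
by rewrite unit_half addrACA; apply: DmaxD; [exact: CA|exact: CB].
Qed.

Lemma CmaxZ n (t : R) (A : 'M[S]_n) : 0 <= t -> Cmax A ->
  Cmax (map_mx (fun v => t%:C *: v) A).
Proof.
rewrite le_eqVlt => /predU1P[<- _|t0 CA r r0].
  suff -> : map_mx (fun v => 0%:C *: v) A = 0 by exact: Cmax0.
  by apply/matrixP => i j; rewrite !mxE scale0r.
have -> : (r%:C *: e)%:M + map_mx (fun v => t%:C *: v) A =
    map_mx (fun v => t%:C *: v) (((r / t)%:C *: e)%:M + A).
  apply/matrixP => i j; rewrite !mxE scalerDr; congr (_ + _).
  case: (i == j); rewrite ?mulr0n ?scaler0// !mulr1n scalerA -rmorphM.
  by rewrite mulrCA divff ?gt_eqF// mulr1.
by apply: DmaxZ; [exact: ltW|apply: CA; rewrite divr_gt0].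
Qed.

Lemma Cmax_proper n (A : 'M[S]_n) : Cmax A -> Cmax (- A) -> A = 0.
Proof. by move=> /Cmax_cone CA /Cmax_cone; exact: mcone_proper. Qed.

Lemma real_bound n (a : 'M[C]_n) : a ^t Num.conj = a ->
  exists2 b : R, 0 < b & psdmx (b%:C%:M - a).
Proof.
move=> /herm_bound[b b0 pb]; exists (complex.Re b).
  by move: b0; rewrite ltcE => /andP[].
by rewrite RRe_real ?gtr0_real.
Qed.

Lemma Cmax_compress n m (X : 'M[C]_(n, m)) (A : 'M[S]_n) :
  Cmax A -> Cmax (compress X A).
Proof.
move=> CA r r0.
have [|b b0 pb] := @real_bound m (X ^t Num.conj *m X).
  by rewrite trmx_mul map_mxM spectral.trmxCK.
have -> : (r%:C *: e)%:M + compress X A =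
    compress X (((r / b)%:C *: e)%:M + A) +
    tensmx ((r / b)%:C *: (b%:C%:M - X ^t Num.conj *m X)) e.
  rewrite compressD -!tensmx_scalar compress_tens mul_mx_scalar -scalemxAl.
  rewrite scalerBr tensmxDl tensmxNl scale_scalar_mx -rmorphM divfK ?gt_eqF//.
  by rewrite [RHS]addrC addrA subrK.
apply: DmaxD; first by apply/Dmax_compress/CA; rewrite divr_gt0.
by apply: Dmax_tens pos_unit; apply: psdmxZ => //; rewrite ler0c divr_ge0// ltW.
Qed.

Let dom n (A : 'M[S]_n) := exists2 r : R, 0 < r & Dmax ((r%:C *: e)%:M - A).

Let domD n (A B : 'M[S]_n) : dom A -> dom B -> dom (A + B).
Proof.
move=> [r r0 DA] [s s0 DB]; exists (r + s); first exact: addr_gt0.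
by rewrite rmorphD scalerDl scalar_mxD opprD addrACA; exact: DmaxD.
Qed.

Let dom0 n : dom (0 : 'M[S]_n).
Proof. by exists 1 => //; rewrite subr0; exact: Dmax_unit. Qed.

Let realcD (s t : R) : (s + t)%:C = s%:C + t%:C :> C.
Proof. exact: rmorphD. Qed.

Let tens_dom_id n (b : 'M[C]_n) (h : S) (s t : C) :
  tensmx (s%:M - b) (t *: e + h) + tensmx (s%:M + b) (t *: e - h) =
  ((s * t + s * t) *: e)%:M - tensmx b (h + h).
Proof.
rewrite !(tensmxDl, tensmxDr, tensmxNl, tensmxNr) !tensmx_scalar !scalerA.
rewrite scalerDl scalar_mxD.
set x := (_ *: e)%:M; set y := (_ *: h)%:M; set z := tensmx _ _; set w := tensmx b h.
by rewrite !opprD addrACA [x + y + _]addrACA subrr addr0 [- z - w + _]addrACA addNr add0r.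
Qed.

Let dom_tens n (b : 'M[C]_n) (h : S) : b ^t Num.conj = b -> star h = h ->
  dom (tensmx b (h + h)).
Proof.
move=> hb hh.
have [s1 s10 p1] := real_bound hb.
have [|s2 s20 p2] := @real_bound n (- b); first by rewrite linearN map_mxN hb.
have [t1 t10 q1] := herm_pos_bound hh.
have [|t2 t20 q2] := @herm_pos_bound (- h).
  by rewrite -scaleN1r starZ rmorphN1 hh.
have [s s0 sE] : exists2 s : R, 0 < s & s%:C = s1%:C + s2%:C :> C.
  by exists (s1 + s2); [rewrite addr_gt0|exact: realcD].
have [t t0 tE] : exists2 t : R, 0 < t & t%:C = t1%:C + t2%:C :> C.
  by exists (t1 + t2); [rewrite addr_gt0|exact: realcD].
have P1 : psdmx (s%:C%:M - b).
  have s2' : 0 <= s2%:C :> C by rewrite ler0c ltW.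
  by have := psdmx_shift s2' p1; rewrite -sE.
have P2 : psdmx (s%:C%:M + b).
  have s1' : 0 <= s1%:C :> C by rewrite ler0c ltW.
  by have := psdmx_shift s1' p2; rewrite opprK [s2%:C + _]addrC -sE.
have Q1 : pos (t%:C *: e - h).
  rewrite tE scalerDl addrAC; apply: posD => //.
  by apply: posZ pos_unit; rewrite ltW.
have Q2 : pos (t%:C *: e + h).
  rewrite tE scalerDl -addrA; apply: posD; last by rewrite -[h]opprK.
  by apply: posZ pos_unit; rewrite ltW.
exists (s * t + s * t); first by rewrite addr_gt0// mulr_gt0.
have := DmaxD (Dmax_tens P1 Q2) (Dmax_tens P2 Q1); rewrite tens_dom_id.
by have -> : (s * t + s * t)%:C = s%:C * t%:C + s%:C * t%:C by rewrite realcD rmorphM.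
Qed.

Let sum_delta n (F : 'M[S]_n) :
  \sum_p \sum_q tensmx (delta_mx p q) (F p q) = F.
Proof.
apply/matrixP => i j; rewrite summxE (bigD1 i)//= [X in _ + X]big1.
  rewrite addr0 summxE (bigD1 j)//= big1 => [|q /negPf qj].
    by rewrite addr0 !mxE !eqxx scale1r.
  by rewrite !mxE [j == q]eq_sym qj andbF scale0r.
move=> p /negPf pi; rewrite summxE big1// => q _.
by rewrite !mxE [i == p]eq_sym pi scale0r.
Qed.

Let sum_deltaT n (F : 'M[S]_n) :
  \sum_p \sum_q tensmx (delta_mx q p) (F p q) = F^T.
Proof.
rewrite exchange_big/= -[RHS]sum_delta; apply: eq_bigr => p _.
by apply: eq_bigr => q _; rewrite mxE.
Qed.

Let herm_dom n (A : 'M[S]_n) : adjmx (@star _ S) A = A -> dom A.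
Proof.
move=> hA; have hAE i j : star (A i j) = A j i.
  by rewrite -[in RHS]hA !mxE.
pose H p q := 8^-1 *: (A p q + star (A p q)) : S.
pose K p q := (8^-1 * 'i) *: (A p q - star (A p q)) : S.
pose F := \matrix_(p, q) (H p q + H p q) : 'M[S]_n.
pose G := \matrix_(p, q) (- 'i *: (K p q + K p q)) : 'M[S]_n.
have AE : A = F + F^T + (G - G^T).
  apply/matrixP => i j; rewrite !mxE /H /K !hAE [A j i + _]addrC.
  exact: herm_split.
have {}AE : A = \sum_p \sum_q
    (tensmx (delta_mx p q + delta_mx q p) (H p q + H p q) +
     tensmx (- 'i *: (delta_mx p q - delta_mx q p)) (K p q + K p q)).
  rewrite [LHS]AE -!sum_deltaT -{1}[F]sum_delta -{1}[G]sum_delta.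
  rewrite -sumrB -!big_split; apply: eq_bigr => p _.
  rewrite -sumrB -!big_split; apply: eq_bigr => q _ /=.
  by rewrite !mxE tensmxDl -[in RHS]tensmxZ tensmxDl tensmxNl.
rewrite AE.
elim/big_ind: _ => [|B D|p _]; [exact: dom0|exact: domD|].
elim/big_ind: _ => [|B D|q _]; [exact: dom0|exact: domD|].
apply: domD; apply: dom_tens.
- exact: herm_delta.
- by rewrite /H starZ starD starK addrC fmorphV rmorph_nat.
- exact: herm_idelta.
- rewrite /K starZ starB starK rmorphM fmorphV rmorph_nat /= conjCi.
  by rewrite mulrN scaleNr -scalerN opprB.
Qed.

Lemma Cmax_order n (A : 'M[S]_n) : adjmx (@star _ S) A = A ->
  exists2 r : R, 0 < r & Cmax ((r%:C *: e)%:M - A).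
Proof. by move=> /herm_dom[r r0 DA]; exists r => //; exact: Dmax_Cmax. Qed.

Lemma Cmax_arch n (A : 'M[S]_n) :
  (forall r : R, 0 < r -> Cmax ((r%:C *: e)%:M + A)) -> Cmax A.
Proof.
move=> h r r0; have r20 : 0 < r / 2 by rewrite divr_gt0.
by rewrite unit_half -addrA; apply: h.
Qed.

Definition OMAX : opsystem R :=
  @OpSystem R (OMAX_mspace S) (@star R S) (@star_conjlinear R S) (@starK R S)
    Cmax_herm Cmax0 CmaxD CmaxZ Cmax_proper Cmax_compress (munit_herm S)
    Cmax_order Cmax_arch.

(* the identity map of the common underlying vector space *)
Definition id_OMAX : {linear S -> OMAX} := [the {linear S -> S} of idfun].

End OmaxIsOpsystem.

Record hilbert (R : realType) := Hilbert {
  hilbert_sort :> completeNormedModType R[i];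
  hdot : {dot hilbert_sort for Num.conj};
  hdotE : forall x : hilbert_sort, hdot x x = `|x| ^+ 2
}.

Section BoundedOperators.
Variables (R : realType) (H : hilbert R).
Local Notation C := R[i].

Definition bop_pred : {pred (H -> H)} := mem [set f : H -> H |
  linear f /\ exists M : R, forall x, `|f x| <= M%:C * `|x|].

Lemma bop_submod_closed : subsemimod_closed bop_pred.
Proof.
split; [split|].
- rewrite inE; split; first by move=> a u v; rewrite scaler0 addr0.
  by exists 0 => x; rewrite normr0 mul0r.
- move=> f g; rewrite !inE => -[lf [M fM]] [lg [N gN]]; split.
    by move=> a u v; rewrite !fctE lf lg scalerDr addrACA.
  exists (M + N) => x; rewrite rmorphD mulrDl.
  by rewrite fctE (le_trans (ler_normD _ _))// lerD.
- move=> a f; rewrite !inE => -[lf [M fM]]; split.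
    by move=> b u v; rewrite !fctE lf scalerDr !scalerA mulrC.
  have aE : `|a| = (complex.Re `|a|)%:C by rewrite RRe_real ?normr_real.
  exists (complex.Re `|a| * M) => x; rewrite fctE normrZ.
  have -> : (complex.Re `|a| * M)%:C = `|a| * M%:C by rewrite {2}aE -rmorphM.
  by rewrite -mulrA ler_wpM2l.
Qed.

Record bop := BOp { bop_fun :> H -> H; bop_funP : bop_fun \in bop_pred }.

HB.instance Definition _ := [isSub for bop_fun].
HB.instance Definition _ := [Choice of bop by <:].
HB.instance Definition _ :=
  GRing.SubChoice_isSubLmodule.Build C (H -> H) bop_pred bop bop_submod_closed.

Lemma bop_id_subproof : @idfun H \in bop_pred.
Proof.
by rewrite inE; split=> //; exists 1 => x; rewrite mul1r.
Qed.

Definition bop_id : bop := BOp bop_id_subproof.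

Definition opnorm (A : bop) : R :=
  sup [set complex.Re `|A x| | x in [set x : H | `|x| <= 1]].

(* positivity of (A i j) as an operator on the Hilbert space H^n *)
Definition bop_cone n : set 'M[bop]_n := [set A : 'M[bop]_n |
  forall x : 'I_n -> H, 0 <= \sum_i \sum_j hdot H (A i j (x j)) (x i)].

Definition BH : mspace R := MSpace bop_cone bop_id.

End BoundedOperators.

Definition cp_decomposition (R : realType) (S : mspace R) (H : hilbert R)
    (phi phi1 phi2 : {linear S -> BH H}) :=
  [/\ completely_positive phi1, completely_positive phi2 &
      forall v, phi v = phi1 v - phi2 v].

(* Main.v *)
Require Import Defs.
From HB Require Import structures.
From mathcomp Require Import all_boot all_order all_algebra.
From mathcomp Require Import all_classical all_reals all_analysis.
From mathcomp Require Import complex ring lra.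

Set Implicit Arguments.
Unset Strict Implicit.
Unset Printing Implicit Defensive.

Import Order.TTheory GRing.Theory Num.Theory.
Import numFieldNormedType.Exports.

Local Open Scope classical_set_scope.
Local Open Scope complex_scope.
Local Open Scope sesquilinear_scope.
Local Open Scope ring_scope.

(** A unital positive map [phi] out of [S] is the same thing as a unital
    completely positive map out of OMAX(S); hence it contracts the norms of
    OMAX(S), and the supremum in (ii) is attained at the identity, with value
    the cb-norm [c] of (i).

    Wittstock's decomposition of [phi : S -> B(H)] is obtained without an
    extension theorem into B(H). A completely positive [psi] with [psi +- phi]
    completely positive and [psi e <= c] is the same as a functional on the
    algebraic tensor product of [S] with the finite-rank operators on [H],
    subject to linear inequalities; by Hahn-Banach it exists as soon as these
    are consistent. Consistency says that [A + B = T (x) e] with [A, B >= 0]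
    forces [<phi(A - B) x, x> <= c <phi(T (x) e) x, x>]. After conjugation by
    [T^(-1/2)] this is the statement that [-1 <= X <= 1] in [M_n(S)] implies
    [X <= c] in OMAX(S), i.e. (i). Riesz representation turns the functional
    into an operator-valued map.

    Conversely, if [A] is a contraction in [M_n(S)] and [[t, A], [A^*, t]] is
    not positive in OMAX(S), separating it from the cone gives a positive map into
    matrices, made unital after a small perturbation, that does not send this
    block to a positive matrix; a decomposition [phi1 - phi2] of that map with
    [phi1(e) + phi2(e) < t] would contradict this. *)

(** * Hahn-Banach for consistent systems of inequalities *)

Section ConeHahnBanach.
Variables (R : realType) (V : lmodType R[i]).
Local Notation C := R[i].
Implicit Types (K M : set (V * R)) (u v w : V) (s t a : R).

(* [K] collects constraints [f v <= t] on a real functional [f]; the last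
   clause replaces the usual domination by a sublinear functional. *)
Definition consistent K :=
  [/\ forall v w s t, K (v, s) -> K (w, t) -> K (v + w, s + t),
      forall a v t, 0 < a -> K (v, t) -> K (a%:C *: v, a * t),
      forall t, K (0, t) -> 0 <= t &
      forall v t, K (v, t) -> exists s, K (- v, s)].

(** Adding a bound at [v] to a bound at [- v] gives a constraint at 0, whose bound is nonnegative.
    So every lower bound for the value at [v] lies below every upper bound, and an infimum separates
    them. *)
Lemma consistent_between M v : consistent M ->
  exists a, (forall t, M (v, t) -> a <= t) /\ (forall t, M (- v, t) -> - t <=
    a).
Proof.
move=> [MD MZ M0 MN].
have le_tr s t : M (v, s) -> M (- v, t) -> - t <= s.
  by move=> Mv /(MD _ _ _ _ Mv); rewrite subrr => /M0; lra.
have [[t0 Mt0]|nM] := pselect (exists t, M (v, t)); last first.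
  (* Without a bound at [v] there is none at [- v] either, by the closure under opposites; any value
     then works. *)
  exists 0; split=> t Mt; first by case: nM; exists t.
  by case: nM; have [s] := MN _ _ Mt; rewrite opprK; exists s.
exists (inf [set t | M (v, t)]); split=> t Mt.
  apply: ge_inf Mt; have [s Ms] := MN _ _ Mt0.
  by exists (- s) => r Mr; exact: le_tr Mr Ms.
by apply: lb_le_inf; [exists t0|move=> s Ms; exact: le_tr Ms Mt].
Qed.

(** The one-dimensional step of Hahn-Banach: two opposite constraints at [v] prescribe the value [a]
    there. *)
Lemma consistent_extend M v : consistent M -> M (0, 0) ->
  exists a M', [/\ consistent M', M `<=` M', M' (v, a) & M' (- v, - a)].
Proof.
move=> cM M00; have [a [a_lb a_ub]] := consistent_between v cM.
have [MD MZ M0 MN] := cM.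
exists a, [set p | exists l w t,
  [/\ M (w, t), p.1 = w + l%:C *: v & p.2 = t + l * a]].
split.
- split.
  + move=> _ _ _ _ [l1 [w1 [t1 [M1 /= -> ->]]]] [l2 [w2 [t2 [M2 /= -> ->]]]].
    exists (l1 + l2), (w1 + w2), (t1 + t2); split=> /=; first exact: MD.
      by rewrite rmorphD scalerDl addrACA.
    by rewrite mulrDl addrACA.
  + move=> b _ _ b0 [l [w [t [Mw /= -> ->]]]].
    exists (b * l), (b%:C *: w), (b * t); split=> /=; first exact: MZ.
      by rewrite scalerDr scalerA rmorphM.
    by rewrite mulrDr mulrA.
  + move=> _ [l [w [t [Mw /= /esym/eqP + ->]]]].
    rewrite addr_eq0 => /eqP wE.
    (* A constraint of the enlarged system at 0 has [w = - (l%:C *: v)]; dividing by [l] or [- l]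
       turns it into one of the bounds that [a] obeys. *)
    have [l0|l0|l0] := ltgtP l 0; last first.
    * by move: Mw; rewrite wE l0 scale0r oppr0 mul0r addr0; exact: M0.
    * have := MZ _ _ _ _ Mw; move=> /(_ l^-1); rewrite invr_gt0 => /(_ l0).
      rewrite wE scalerN scalerA -rmorphM mulVf ?gt_eqF// scale1r => /a_ub.
      by rewrite -(ler_pM2l l0) mulrN mulVKf ?gt_eqF//; lra.
    * have := MZ _ _ _ _ Mw; move=> /(_ (- l)^-1).
      rewrite invr_gt0 oppr_gt0 => /(_ l0).
      rewrite wE -scaleNr -rmorphN scalerA -rmorphM mulVf ?oppr_eq0 ?lt_eqF//.
      rewrite scale1r => /a_lb.
      have l0' : 0 < - l by rewrite oppr_gt0.
      by rewrite -(ler_pM2l l0') mulVKf ?gt_eqF//; lra.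
  + move=> _ _ [l [w [t [Mw /= -> _]]]].
    have [s Ms] := MN _ _ Mw.
    exists (s + - l * a), (- l), (- w), s; split=> //=.
    by rewrite rmorphN scaleNr opprD.
- by move=> [w t] Mw; exists 0, w, t; split; rewrite ?scale0r ?mul0r ?addr0.
- by exists 1, 0, 0; split; rewrite ?scale1r ?mul1r ?add0r.
- by exists (- 1), 0, 0; split;
  rewrite ?rmorphN ?scaleNr ?scale1r ?mulN1r ?add0r.
Qed.

Lemma consistent_functional K : consistent K -> K (0, 0) ->
  exists f : V -> R, [/\ forall u v, f (u + v) = f u + f v,
    forall a u, f (a%:C *: u) = a * f u &
    forall v t, K (v, t) -> f v <= t].
Proof.
move=> cK K00.
(* The inclusion of [K] is asked of nonempty systems only, because Zorn's lemma also runs over the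
   empty chain, whose union is empty. *)
pose P := [set M | consistent M /\ (M !=set0 -> K `<=` M)].
have [F FP Ftot|M [[cM M0K] Mmax]] := @Zorn_bigcup _ P.
  split=> [|[x [X FX Xx]]]; last first.
    have [_ /(_ _) KX] := FP _ FX.
    by move=> y Ky; exists X => //; apply: KX => //; exists x.
  split.
  - move=> v w s t [X FX Xv] [Y FY Yw].
    have [XY|YX] := Ftot _ _ FX FY; [exists Y|exists X] => //.
      by have [[D _ _ _] _] := FP _ FY; apply: D => //; exact: XY.
    by have [[D _ _ _] _] := FP _ FX; apply: D => //; exact: YX.
  - move=> a v t a0 [X FX Xv]; exists X => //.
    by have [[_ Z _ _] _] := FP _ FX; exact: Z.
  - by move=> t [X FX Xv]; have [[_ _ Z _] _] := FP _ FX; exact: Z.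
  - move=> v t [X FX Xv]; have [[_ _ _ N] _] := FP _ FX.
    by have [s Xs] := N _ _ Xv; exists s, X.
have KM : K `<=` M.
  have [[x Mx]|M0] := pselect (M !=set0); first exact: M0K (ex_intro _ x Mx).
  exfalso; apply: (Mmax K); last first.
    by split; [exact: cK|move=> _ y Ky].
  split; first by move=> x Mx; case: M0; exists x.
  by move=> /(_ _ K00) MK; case: M0; exists (0, 0).
have M00 := KM _ K00.
(* A maximal system coincides with its one-dimensional extensions, so it already prescribes a value
   at every vector. *)
have exf v : exists a, M (v, a) /\ M (- v, - a).
  have [a [M' [cM' MM' Mv MNv]]] := consistent_extend v cM M00.
  suff -> : M = M' by exists a.
  apply/seteqP; split=> //; apply: contrapT => nM'M.
  by apply: (Mmax M') => //; split=> // _; exact: subset_trans MM'.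
have [MD MZ M0 MN] := cM.
have /choice[f fM] := exf.
have f_le v t : M (v, t) -> f v <= t.
  move=> Mv; have [_ Mf] := fM v.
  by have := MD _ _ _ _ Mv Mf; rewrite subrr => /M0; lra.
(* Opposite constraints determine the value, so the linearity of [f] follows from the closure
   properties of [M]. *)
have f_uniq v t : M (v, t) -> M (- v, - t) -> f v = t.
  move=> Mv MNv; apply/eqP; rewrite eq_le f_le//=.
  have [Mf _] := fM v.
  by have := MD _ _ _ _ Mf MNv; rewrite subrr => /M0; lra.
have fD u v : f (u + v) = f u + f v.
  have [[? ?] [? ?]] := (fM u, fM v).
  by apply: f_uniq; rewrite ?opprD; exact: MD.
have fN u : f (- u) = - f u.
  by have [? ?] := fM u; apply: f_uniq; rewrite ?opprK.
have fZ a u : 0 < a -> f (a%:C *: u) = a * f u.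
  have [? ?] := fM u; move=> a0.
  by apply: f_uniq; rewrite -?mulrN -?scalerN; exact: MZ.
exists f; split=> // [a u|v t Kv]; last exact/f_le/KM.
have [a0|a0|->] := ltgtP a 0; last first.
- by rewrite scale0r mul0r; apply: f_uniq; rewrite ?oppr0.
- exact: fZ.
- have /(fZ _ u) : 0 < - a by rewrite oppr_gt0.
  by rewrite rmorphN scaleNr fN mulNr => /oppr_inj.
Qed.

Lemma consistent_complex_functional K : consistent K -> K (0, 0) ->
  exists F : V -> C, (forall c u v, F (c *: u + v) = c * F u + F v) /\
    forall v t, K (v, t) -> complex.Re (F v) <= t.
Proof.
move=> cK K00; have [f [fD fZ fK]] := consistent_functional cK K00.
have fN u : f (- u) = - f u.
  by rewrite -scaleN1r -[in LHS](rmorphN1 (real_complex R)) fZ mulN1r.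
(* The usual complexification F(v) = f(v) - i f(iv), with real part f. *)
exists (fun v => f v +i* - f ('i%C *: v)); split; last by move=> v t /fK.
move=> [a b] u v; apply/eqP; rewrite eq_complex /=.
have E w : (a +i* b) *: w = a%:C *: w + b%:C *: ('i%C *: w).
  rewrite scalerA -scalerDl; congr (_ *: _).
  by apply/eqP; rewrite eq_complex /=; apply/andP; split; apply/eqP; ring.
have ii w : 'i%C *: ('i%C *: w) = - w.
  rewrite scalerA -[RHS]scaleN1r; congr (_ *: _).
  by apply/eqP; rewrite eq_complex /=; apply/andP; split; apply/eqP; ring.
rewrite scalerDr scalerA [X in f (X *: u + 'i%C *: v)]mulrC -scalerA.
rewrite !E !fD !fZ ii fN.
by apply/andP; split; apply/eqP; ring.
Qed.

End ConeHahnBanach.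

(** * Hilbert spaces and Riesz representation *)

Section ComplexParts.
Variable R : realType.
Local Notation C := R[i].
Implicit Types (x y z : C) (a : R).

Lemma cReD x y : complex.Re (x + y) = complex.Re x + complex.Re y.
Proof. by case: x y => [? ?] [? ?]. Qed.

Lemma cReN x : complex.Re (- x) = - complex.Re x.
Proof. by case: x. Qed.

Lemma cReB x y : complex.Re (x - y) = complex.Re x - complex.Re y.
Proof. by rewrite cReD cReN. Qed.

Lemma cReZ a x : complex.Re (a%:C * x) = a * complex.Re x.
Proof. by case: x => ? ? /=; rewrite mul0r subr0. Qed.

Lemma cReJ x : complex.Re x^* = complex.Re x.
Proof. by case: x. Qed.

Lemma cRealJ a : (a%:C)^* = a%:C.
Proof. by apply/eqP; rewrite eq_complex /= oppr0 !eqxx. Qed.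

Lemma cRe_le x y : x <= y -> complex.Re x <= complex.Re y.
Proof. by rewrite lecE => /andP[]. Qed.

Lemma cRe_sum (I : Type) (r : seq I) (P : pred I) (F : I -> C) :
  complex.Re (\sum_(i <- r | P i) F i) = \sum_(i <- r | P i) complex.Re (F i).
Proof. by elim/big_rec2: _ => // i y1 y2 _ <-; rewrite cReD. Qed.

Lemma cRe_le_norm x : complex.Re x <= complex.Re `|x|.
Proof. by have := normc_ge_Re x => /cRe_le /=; apply: le_trans;
  exact: ler_norm. Qed.

Lemma normr_cRe (V : normedZmodType C) (v : V) : (complex.Re `|v|)%:C = `|v|.
Proof. by rewrite RRe_real ?normr_real. Qed.

Lemma ge0_cRe x : 0 <= x -> (complex.Re x)%:C = x.
Proof. by move=> x0; rewrite RRe_real ?ger0_real. Qed.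

Lemma norm_le_rotations x a :
  (forall c : C, `|c| = 1 -> complex.Re (c * x) <= a) -> `|x| <= a%:C.
Proof.
move=> h; have [x0|x0] := eqVneq x 0.
  by have := h 1 (normr1 _); rewrite x0 mulr0 normr0 -lecR.
rewrite -normr_cRe lecR; have := h (`|x| / x).
rewrite normf_div normr_id divff ?normr_eq0// divfK//; exact.
Qed.

End ComplexParts.

Section HilbertTheory.
Variables (R : realType) (H : hilbert R).
Local Notation C := R[i].
Local Notation "''[' x , y ]" := (hdot H x y) : ring_scope.
Implicit Types (x y z : H) (a : C).

Lemma dotDl x y z : '[x + y, z] = '[x, z] + '[y, z].
Proof. by rewrite linearDl. Qed.

Lemma dotDr x y z : '[x, y + z] = '[x, y] + '[x, z].
Proof. by rewrite linearD. Qed.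

Lemma dotZl a x y : '[a *: x, y] = a * '[x, y].
Proof. by rewrite linearZl_LR. Qed.

Lemma dotZr a x y : '[x, a *: y] = a^* * '[x, y].
Proof. by rewrite linearZr_LR. Qed.

Lemma dotC x y : '[x, y] = '[y, x]^*.
Proof. by rewrite hermC expr0 mul1r. Qed.

Lemma dotNl x y : '[- x, y] = - '[x, y].
Proof. by rewrite -scaleN1r dotZl mulN1r. Qed.

Lemma dotNr x y : '[x, - y] = - '[x, y].
Proof. by rewrite [in RHS]dotC dotC dotNl rmorphN. Qed.

Lemma dot0l x : '[0, x] = 0.
Proof. by rewrite -(scale0r 0) dotZl mul0r. Qed.

Lemma dot0r x : '[x, 0] = 0.
Proof. by rewrite dotC dot0l rmorph0. Qed.

Lemma dot_suml (I : Type) (r : seq I) (F : I -> H) y :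
  '[\sum_(i <- r) F i, y] = \sum_(i <- r) '[F i, y].
Proof. by elim/big_rec2: _ => [|i y1 y2 _ <-]; rewrite ?dot0l ?dotDl. Qed.

Lemma dot_sumr (I : Type) (r : seq I) (F : I -> H) y :
  '[y, \sum_(i <- r) F i] = \sum_(i <- r) '[y, F i].
Proof. by elim/big_rec2: _ => [|i y1 y2 _ <-]; rewrite ?dot0r ?dotDr. Qed.

Lemma dot_ge0 x : 0 <= '[x, x].
Proof. by rewrite hdotE exprn_ge0. Qed.

Lemma dot_eq0 x : ('[x, x] == 0) = (x == 0).
Proof. by rewrite hdotE expf_eq0 normr_eq0. Qed.

Lemma dot_inj x y : (forall z, '[x, z] = '[y, z]) -> x = y.
Proof.
move=> h; apply/eqP; rewrite -subr_eq0 -dot_eq0 dotDl dotNl h.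
by rewrite subrr.
Qed.

(** Norms over R[i] are complex-valued; this real copy is the one on which ordered-field reasoning
    over [R] acts. *)
Definition hnorm x : R := complex.Re `|x|.

Lemma hnormE x : `|x| = (hnorm x)%:C.
Proof. by rewrite normr_cRe. Qed.

Lemma hnorm_ge0 x : 0 <= hnorm x.
Proof. by rewrite -ler0c -hnormE. Qed.

Lemma hdot_norm x : complex.Re '[x, x] = hnorm x ^+ 2.
Proof. by rewrite hdotE hnormE -rmorphXn. Qed.

Lemma hnormZ (a : R) x : hnorm (a%:C *: x) = `|a| * hnorm x.
Proof.
apply: complexI; rewrite rmorphM -hnormE normrZ hnormE; congr (_ * _).
by rewrite normc_def/= expr0n addr0 sqrtr_sqr.
Qed.

Lemma hnorm_cauchy x y : complex.Re '[x, y] <= hnorm x * hnorm y.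
Proof.
have key (t : R) :
    0 <= hnorm x ^+ 2 - 2 * t * complex.Re '[x, y] + t ^+ 2 * hnorm y ^+ 2.
  have := dot_ge0 (x - t%:C *: y) => /cRe_le.
  rewrite dotDl !dotDr !dotNl !dotNr !dotZl !dotZr !cRealJ.
  rewrite opprK !(cReD, cReN, cReZ) !hdot_norm [in '[y, x]]dotC cReJ /=.
  by lra.
have [y0|y0] := eqVneq (hnorm y) 0.
  have [->|r0] := eqVneq (complex.Re '[x, y]) 0; first by rewrite y0 mulr0.
  (* When y has norm zero the quadratic in t is affine, and this t makes it equal to -1. *)
  have := key ((hnorm x ^+ 2 + 1) / (2 * complex.Re '[x, y])).
  rewrite y0 expr0n mulr0 addr0.
  have -> : forall a b : R, b != 0 -> 2 * (a / (2 * b)) * b = a.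
    by move=> a b b0; field.
  by lra.
  by [].
have y1 : 0 < hnorm y by rewrite lt_def y0 hnorm_ge0.
set r := complex.Re _ in key *.
have := key (r / hnorm y ^+ 2).
have -> : hnorm x ^+ 2 - 2 * (r / hnorm y ^+ 2) * r +
   (r / hnorm y ^+ 2) ^+ 2 * hnorm y ^+ 2 = ((hnorm x * hnorm y) ^+ 2 - r ^+ 2)
     / hnorm y ^+ 2.
  by field.
rewrite pmulr_lge0 ?invr_gt0 ?exprn_gt0// subr_ge0 => h.
apply: le_trans (ler_norm r) _.
by rewrite -(ler_pXn2r (ltn0Sn 1)) ?nnegrE ?mulr_ge0 ?hnorm_ge0// real_normK
  ?num_real.
Qed.

End HilbertTheory.

Section Riesz.
Variables (R : realType) (H : hilbert R).
Local Notation C := R[i].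
Local Notation "''[' x , y ]" := (hdot H x y) : ring_scope.
Variables (l : H -> C) (M : R).
Hypothesis l_lin : forall (a : C) u v, l (a *: u + v) = a * l u + l v.
Hypothesis l_bnd : forall x, complex.Re (l x) <= M * hnorm x.

(** If z represents [l], then J(x) = |x - z|^2 - |z|^2; accordingly z is found as a limit of
    near-minimisers of [J]. *)
Let J (x : H) : R := hnorm x ^+ 2 - 2 * complex.Re (l x).

Let lD u v : l (u + v) = l u + l v.
Proof. by rewrite -[u in LHS]scale1r l_lin mul1r. Qed.

Let l0 : l 0 = 0.
Proof. by apply: (addrI (l 0)); rewrite -lD !addr0. Qed.

Let lZ a u : l (a *: u) = a * l u.
Proof. by rewrite -[a *: u]addr0 l_lin l0 addr0. Qed.

Let J_ge x : - M ^+ 2 <= J x.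
Proof. by rewrite /J; have := l_bnd x; have := sqr_ge0 (hnorm x - M); lra. Qed.

Let m := inf (range J).

Let m_le x : m <= J x.
Proof. by apply: ge_inf; [exists (- M ^+ 2) => _ [y _ <-]|exists x]. Qed.

Let JD x y (t : R) : J (x + t%:C *: y) =
  J x + t ^+ 2 * hnorm y ^+ 2 + 2 * t * (complex.Re '[y, x] - complex.Re (l y)).
Proof.
rewrite /J lD lZ -!hdot_norm dotDl !dotDr !dotZl !dotZr !cRealJ.
by rewrite ['[x, y]]dotC !(cReD, cReZ) cReJ; ring.
Qed.

(** Moving a near-minimiser along y lowers [J] by at most [e]. The resulting nonnegative quadratic
    in t bounds its linear coefficient: an approximate Euler-Lagrange equation. *)
Let J_opt x y (e : R) : J x <= m + e ->
  (complex.Re '[y, x] - complex.Re (l y)) ^+ 2 <= e * hnorm y ^+ 2.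
Proof.
move=> xe; set b := _ - _.
have key t : 0 <= e + t ^+ 2 * hnorm y ^+ 2 + 2 * t * b.
  by have := m_le (x + t%:C *: y); rewrite JD -/b; lra.
have [y0|y0] := eqVneq (hnorm y) 0.
  have -> : b = 0; last by rewrite y0 !expr0n mulr0.
  apply/eqP; apply: contraT => b0; have := key (- (e + 1) / (2 * b)).
  rewrite y0 expr0n mulr0 addr0.
  by have -> : 2 * (- (e + 1) / (2 * b)) * b = - (e + 1) by [field]; lra.
have y1 : 0 < hnorm y ^+ 2 by rewrite exprn_even_gt0.
have := key (- b / hnorm y ^+ 2).
have -> : e + (- b / hnorm y ^+ 2) ^+ 2 * hnorm y ^+ 2 +
    2 * (- b / hnorm y ^+ 2) * b = (e * hnorm y ^+ 2 - b ^+ 2) / hnorm y ^+ 2.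
  by field.
by rewrite pmulr_lge0 ?invr_gt0// subr_ge0.
Qed.

(** The parallelogram law at the midpoint, where [J] is at least [m]: minimising sequences are
    Cauchy. *)
Let J_near x y (e : R) : J x <= m + e -> J y <= m + e ->
  hnorm (x - y) ^+ 2 <= 4 * e.
Proof.
move=> xe ye; have := m_le ((2^-1 : R)%:C *: (x + y)).
have -> : J ((2^-1 : R)%:C *: (x + y)) =
    2^-1 * J x + 2^-1 * J y - 4^-1 * hnorm (x - y) ^+ 2.
  rewrite /J lZ lD -!hdot_norm dotZl dotZr cRealJ !dotDl !dotDr !dotNl !dotNr.
  by rewrite ['[y, x]]dotC !(cReZ, cReD, cReN) cReJ; field.
by lra.
Qed.

Lemma riesz : exists z, forall x, l x = '[x, z].
Proof.
have eps0 n : 0 < n.+1%:R^-1 :> R by rewrite invr_gt0.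
have ex n : exists x, J x <= m + n.+1%:R^-1.
  have [_ [x _ <-] Jx] : exists2 r, range J r & r < m + n.+1%:R^-1.
    apply: inf_adherent => //; split; first by exists (J 0), 0.
    by exists (- M ^+ 2) => _ [y _ <-].
  by exists x; exact: ltW.
have /choice[x_ Jx_] := ex.
have small (d : R) : 0 < d -> exists N, forall n, (N <= n)%N -> n.+1%:R^-1 <= d.
  move=> d0; exists (Num.truncn d^-1) => n Nn.
  rewrite -[leRHS]invrK lef_pV2 ?posrE ?invr_gt0//.
  rewrite ltW// (lt_le_trans (truncnS_gt _))// ler_nat//.
have cvx : cvg (x_ @ \oo).
  apply: cauchy_cvg; apply: cauchy_exP => e e0.
  have eE : e = (complex.Re e)%:C by rewrite ge0_cRe ?ltW.
  have e1 : 0 < complex.Re e by rewrite -ltcR -eE.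
  have [|N NP] := small ((complex.Re e / 3) ^+ 2);
    first by rewrite exprn_gt0// divr_gt0.
  exists (x_ N), N => // n /= Nn; rewrite -ball_normE /ball_ /= eE hnormE ltcR.
  have : hnorm (x_ N - x_ n) ^+ 2 <= 4 * (complex.Re e / 3) ^+ 2.
    by apply: J_near; apply: (le_trans (Jx_ _)); rewrite lerD2l NP.
  move=> h; rewrite -(ltr_pXn2r (ltn0Sn 1)) ?nnegrE ?hnorm_ge0 ?(ltW e1)//.
  apply: le_lt_trans h _.
  have : 0 < complex.Re e ^+ 2 by rewrite exprn_gt0.
  by lra.
have [z xz] := (cvg_ex _).1 cvx.
have near (d : R) : 0 < d -> exists2 x, J x <= m + d ^+ 2 & hnorm (z - x) <= d.
  move=> d0; have [|N NP] := small (d ^+ 2); first by rewrite exprn_gt0.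
  have dC : 0 < d%:C :> C by rewrite ltcR.
  have /cvgrPdist_le/(_ _ dC)[N' _ N'P] := xz.
  exists (x_ (maxn N N')).
    by apply: (le_trans (Jx_ _)); rewrite lerD2l NP// leq_maxl.
  by have := N'P (maxn N N') (leq_maxr _ _); rewrite hnormE lecR.
(* The approximate equation passes to the limit with two errors of at most q|y| each. Replacing y by
   -y and then by iy gives equality and the imaginary part. *)
have Rez y : complex.Re '[y, z] - complex.Re (l y) <= 0.
  apply/ler_addgt0Pr => d d0; rewrite add0r.
  have [q q0 qE] : exists2 q : R, 0 < q & q * (2 * (hnorm y + 1)) = d.
    exists (d / (2 * (hnorm y + 1))); last first.
      by rewrite divfK// gt_eqF// mulr_gt0// ltr_wpDl ?hnorm_ge0.
    by rewrite divr_gt0 ?mulr_gt0 ?ltr_wpDl ?hnorm_ge0.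
  have [x Jx zx] := near _ q0; have := J_opt y Jx.
  have -> : z = (z - x) + x by rewrite subrK.
  rewrite dotDr cReD -exprMn => h.
  have h1 : complex.Re '[y, x] - complex.Re (l y) <= q * hnorm y.
    apply: le_trans (ler_norm _) _.
    rewrite -(ler_pXn2r (ltn0Sn 1)) ?nnegrE ?mulr_ge0 ?hnorm_ge0 ?(ltW q0)//.
    by rewrite real_normK ?num_real.
  have h2 := hnorm_cauchy y (z - x).
  have h3 : hnorm y * hnorm (z - x) <= hnorm y * q.
    by rewrite ler_wpM2l ?hnorm_ge0.
  by lra.
have Rez' y : complex.Re (l y) = complex.Re '[y, z].
  have := Rez y; have := Rez (- y).
  by rewrite -scaleN1r lZ dotZl !mulN1r !cReN; lra.
exists z => y; have := Rez' y; have := Rez' ('i%C *: y).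
rewrite lZ dotZl; case: (l y) ('[y, z]) => [a b] [c d] /=.
by rewrite !mul0r !mul1r !sub0r => /oppr_inj -> ->.
Qed.

End Riesz.

(** * Operator norms and operators defined by bounded forms *)

Section BoundedOperatorTheory.
Variables (R : realType) (H : hilbert R).
Local Notation C := R[i].
Local Notation "''[' x , y ]" := (hdot H x y) : ring_scope.
Implicit Types (A B : bop H) (x y : H).

Lemma bop_lin A (a : C) x y : A (a *: x + y) = a *: A x + A y.
Proof. by case: A => A /= + ; rewrite inE => -[lA _]; rewrite lA. Qed.

Lemma bopD A x y : A (x + y) = A x + A y.
Proof. by rewrite -[x in LHS]scale1r bop_lin scale1r. Qed.

Lemma bop0 A : A 0 = 0.
Proof. by apply: (addrI (A 0)); rewrite -bopD !addr0. Qed.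

Lemma bopZ A a x : A (a *: x) = a *: A x.
Proof. by rewrite -[a *: x]addr0 bop_lin bop0 addr0. Qed.

Lemma bop_addE A B x : (A + B) x = A x + B x.
Proof. by have /(congr1 (fun f : H -> H => f x)) := raddfD (val : bop H -> H ->
  H) A B. Qed.

Lemma bop_scaleE (a : C) A x : (a *: A) x = a *: A x.
Proof. by have /(congr1 (fun f : H -> H => f x)) := GRing.valZ a A. Qed.

Lemma bop_oppE A x : (- A) x = - A x.
Proof. by rewrite -scaleN1r bop_scaleE scaleN1r. Qed.

Lemma bop_zeroE x : (0 : bop H) x = 0.
Proof. by rewrite -(scale0r 0) bop_scaleE scale0r. Qed.

Lemma bop_ext A B : (forall x, A x = B x) -> A = B.
Proof. by move=> h; apply: val_inj; apply/funext. Qed.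

Let bop_normed A : has_sup [set complex.Re `|A x| | x in [set x : H | `|x| <=
  1]].
Proof.
split; first by exists (complex.Re `|A 0|), 0 => //=; rewrite normr0.
case: A => A /= + ; rewrite inE => -[_ [M MA]].
exists `|M| => _ /= [x x1 <-]; rewrite -lecR normr_cRe (le_trans (MA x))//.
have {}x1 : hnorm x <= 1 by rewrite -lecR -hnormE.
rewrite hnormE -rmorphM lecR.
apply: le_trans (ler_norm _) _; rewrite normrM ler_piMr//.
by rewrite ger0_norm ?hnorm_ge0.
Qed.

Lemma opnorm_ge0 A : 0 <= opnorm A.
Proof.
apply: le_trans (hnorm_ge0 (A 0)) _; apply: (sup_upper_bound (bop_normed A)).
by exists 0 => //=; rewrite normr0.
Qed.

Lemma opnorm_apply A x : hnorm (A x) <= opnorm A * hnorm x.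
Proof.
have [x0|x0] := eqVneq (hnorm x) 0.
  have -> : x = 0 by apply/eqP; rewrite -normr_eq0 hnormE x0.
  by rewrite bop0 /hnorm !normr0 mulr0.
have x1 : 0 < hnorm x by rewrite lt_def x0 hnorm_ge0.
have : hnorm (A ((hnorm x)^-1%:C *: x)) <= opnorm A.
  apply: (sup_upper_bound (bop_normed A)); exists ((hnorm x)^-1%:C *: x) => //=.
  rewrite hnormE hnormZ ger0_norm ?invr_ge0 ?hnorm_ge0//.
  by rewrite mulVf.
rewrite bopZ hnormZ ger0_norm ?invr_ge0 ?hnorm_ge0//.
by rewrite ler_pdivrMl// mulrC.
Qed.

Lemma opnorm_le A M : 0 <= M -> (forall x, hnorm (A x) <= M * hnorm x) ->
  opnorm A <= M.
Proof.
move=> M0 h; apply: sup_le_ub; first by have [] := bop_normed A.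
move=> _ [x /= x1 <-]; apply: le_trans (h x) _; rewrite ler_piMr//.
by rewrite -lecR -hnormE.
Qed.

(** For fixed x the conjugate of u(x, .) is a bounded linear functional, and Riesz provides A x.
    Testing against y = A x bounds A. *)
Lemma bounded_form_bop (u : H -> H -> C) (M : R) : 0 <= M ->
  (forall a x y z, u (a *: x + y) z = a * u x z + u y z) ->
  (forall a x y z, u x (a *: y + z) = a^* * u x y + u x z) ->
  (forall x y, `|u x y| <= (M * (hnorm x * hnorm y))%:C) ->
  exists A : bop H, forall x y, u x y = '[A x, y].
Proof.
move=> M0 ul ur ub.
have ex x : exists z, forall y, (u x y)^* = '[y, z].
  apply: (@riesz _ _ (fun y => (u x y)^*) (M * hnorm x)) => [a y z|y].
    rewrite ur rmorphD rmorphM /=; congr (_ * _ + _); exact: conjCK.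
  by rewrite cReJ (le_trans (cRe_le_norm _))// -mulrA; exact: cRe_le (ub x y).
have /choice[A uA] := ex.
have {}uA x y : u x y = '[A x, y] by rewrite dotC -uA conjCK.
have AP : A \in @bop_pred R H.
  rewrite inE; split.
    by move=> a x y; apply: dot_inj => z; rewrite dotDl dotZl -!uA ul.
  exists M => x; rewrite !hnormE -rmorphM lecR.
  have := ub x (A x); rewrite uA hdotE hnormE normrX.
  have [->|Ax0] := eqVneq (hnorm (A x)) 0.
    by move=> _; rewrite mulr_ge0 ?hnorm_ge0.
  have Ax1 : 0 < hnorm (A x) by rewrite lt_def Ax0 hnorm_ge0.
  rewrite normc_def/= expr0n addr0 sqrtr_sqr -rmorphXn lecR ger0_norm
    ?hnorm_ge0//.
  by rewrite expr2 mulrA ler_pM2r.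
by exists (BOp AP).
Qed.

End BoundedOperatorTheory.

(** * Finite-dimensional Hilbert spaces *)

(** A separate name for row vectors keeps their Euclidean norm apart from the sup norm that matrices
    carry. *)
Definition euclid (R : realType) (m : nat) : Type := 'rV[R[i]]_m.

Section Euclid.
Variables (R : realType) (m : nat).
Local Notation C := R[i].
Local Notation E := (euclid R m).

HB.instance Definition _ := GRing.Lmodule.copy E 'rV[C]_m.

Definition edot : E -> E -> C := @dotmx C m.
Definition enorm (x : E) : C := sqrtC (edot x x).

Lemma enormD (x y : E) : enorm (x + y) <= enorm x + enorm y.
Proof. exact: (triangle_lerif (@dotmx C m) x y).1. Qed.

Lemma enormZ (a : C) (x : E) : enorm (a *: x) = `|a| * enorm x.
Proof.
have := dnormZ (@dotmx C m) a x.
rewrite /enorm /edot => ->; rewrite sqrtCM ?nnegrE ?exprn_ge0 ?dnorm_ge0//.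
by rewrite sqrCK.
Qed.

Lemma enorm_eq0 (x : E) : enorm x = 0 -> x = 0.
Proof.
by move=> /eqP; rewrite sqrtC_eq0 (dnorm_eq0 (@dotmx C m)) => /eqP.
Qed.

HB.instance Definition _ :=
  Lmodule_isNormed.Build C E enormD enormZ enorm_eq0.

Let normE (x : E) : `|x| = enorm x.
Proof. by []. Qed.

Let dotE (x y : E) : edot x y = \sum_j x 0 j * (y 0 j)^*.
Proof. by rewrite /edot dotmxE mxE; apply: eq_bigr => j _; rewrite !mxE. Qed.

Lemma euclid_coord_le (x : E) j : `|x 0 j| <= `|x|.
Proof.
rewrite normE /enorm -(sqrCK (normr_ge0 (x 0 j))) ler_sqrtC ?nnegrE
  ?exprn_ge0//; last exact: (dnorm_ge0 (@dotmx C m)).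
by rewrite dotE normCK (bigD1 j)//= lerDl sumr_ge0// => k _;
  rewrite -normCK exprn_ge0.
Qed.

Let norm_le_coord (x : E) : `|x| <= \sum_j `|x 0 j|.
Proof.
have {1}-> : x = \sum_j (x 0 j *: delta_mx 0 j : E) by exact: row_sum_delta.
apply: le_trans (ler_norm_sum _ _ _) _; apply: ler_sum => j _.
rewrite normrZ ler_piMr// normE /enorm dotE (bigD1 j)//= big1 => [|k kj].
  by rewrite addr0 mxE !eqxx -normCK normr1 expr1n sqrtC1.
by rewrite mxE (negPf kj) andbF mul0r.
Qed.

Lemma euclid_complete (F : set_system E) : ProperFilter F -> cauchy F -> cvg F.
Proof.
move=> FF Fc.
(* Used for real and imaginary parts: each coordinate is 1-Lipschitz, hence Cauchy along [F], and
   [R] is complete. *)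
have part (f : C -> R) : (forall a b, `|f a - f b|%:C <= `|a - b|) ->
    forall j, cvg ((fun x : E => f (x 0 j)) @ F).
  move=> fle j; apply: cauchy_cvg; apply: cauchy_exP => e e0.
  have eC : 0 < e%:C :> C by rewrite ltcR.
  have [x Fx] := (cauchyP F).1 Fc _ eC.
  exists (f (x 0 j)); rewrite /fmap /=; apply: filterS Fx => y /=.
  rewrite -!ball_normE /ball_ /= => xy; rewrite -ltcR; apply: le_lt_trans xy.
  by apply: le_trans (fle _ _) _; have := euclid_coord_le (x - y) j;
    rewrite !mxE.
have ex (f : C -> R) : (forall a b, `|f a - f b|%:C <= `|a - b|) ->
    exists l : 'I_m -> R, forall j (e : R), 0 < e ->
      \forall x \near F, `|l j - f ((x : E) 0 j)| <= e.
  move=> fle; exists (fun j => lim ((fun x : E => f (x 0 j)) @ F)) => j e e0.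
  by have /cvgrPdist_le := part f fle j; apply.
have [|a aP] := ex (@complex.Re R).
  by move=> x y; rewrite -cReB normc_ge_Re.
have [|b bP] := ex (@complex.Im R).
  move=> x y; rewrite -[leRHS]mul1r -normCi -normrM.
  apply: le_trans (normc_ge_Re _).
  by case: x y => [? ?] [? ?] /=; rewrite mul0r mul1r sub0r normrN.
apply/cvg_ex; exists (\row_j (a j +i* b j) : E); apply/cvgrPdist_le => e e0.
have eE : e = (complex.Re e)%:C by rewrite ge0_cRe ?ltW.
have e1 : 0 < complex.Re e by rewrite -ltcR -eE.
(* Each of the [m] coordinates has two real components to approximate; [m.+1] keeps the divisor
   nonzero when [m] is 0. *)
have d0 : 0 < complex.Re e / (2 * m.+1%:R) by rewrite divr_gt0 ?mulr_gt0.
have near1 : \forall x \near F, forall j, `|a j - complex.Re ((x : E) 0 j)| <=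
  complex.Re e / (2 * m.+1%:R).
  by apply: filter_forall => j; exact: aP.
have near2 : \forall x \near F, forall j, `|b j - complex.Im ((x : E) 0 j)| <=
  complex.Re e / (2 * m.+1%:R).
  by apply: filter_forall => j; exact: bP.
apply: filterS2 near1 near2 => x h1 h2.
apply: le_trans (norm_le_coord _) _.
have : \sum_(j < m) `|((\row_j (a j +i* b j) : E) - x) 0 j| <=
    \sum_(j < m) (complex.Re e / m.+1%:R)%:C.
  apply: ler_sum => j _; rewrite !mxE.
  have -> : a j +i* b j - x 0 j = (a j - complex.Re (x 0 j))%:C +
      'i%C * (b j - complex.Im (x 0 j))%:C.
    by case: (x 0 j) => c d; apply/eqP; rewrite eq_complex /=; apply/andP;
      split; apply/eqP; ring.
  apply: le_trans (ler_normD _ _) _; rewrite normrM normCi mul1r.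
  rewrite !normc_def /= !expr0n !addr0 !sqrtr_sqr -rmorphD lecR.
  rewrite (_ : _ / m.+1%:R = complex.Re e / (2 * m.+1%:R) + complex.Re e / (2 *
    m.+1%:R)).
    by rewrite lerD.
  by field; rewrite addrC natr1 pnatr_eq0.
move/le_trans; apply; rewrite sumr_const card_ord -rmorphMn eE lecR.
rewrite -mulr_natr -mulrA ler_piMr ?(ltW e1)//.
by rewrite mulrC ler_pdivrMr ?mul1r ?ler_nat.
Qed.

HB.instance Definition _ := Uniform_isComplete.Build E euclid_complete.

HB.instance Definition _ := Dot.copy edot (@dotmx C m).

Definition euclid_hilbert : hilbert R :=
  @Hilbert R (E : completeNormedModType C) edot (fun x => esym (sqrtCK _)).

Lemma euclid_dotE (x y : euclid_hilbert) :
  hdot euclid_hilbert x y = ((x : 'rV[C]_m) *m (y : 'rV[C]_m) ^t Num.conj) 0 0.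
Proof. exact: (dotmxE (x : 'rV[C]_m) y). Qed.

End Euclid.

(** * Operator-valued quadratic forms *)

Section Forms.
Variables (R : realType) (S E W : lmodType R[i]).
Local Notation C := R[i].

(** Linear in [S], sesquilinear in [E]. The target is general because the forms are scalar in some
    places and [S]-valued kernels in others. *)
Definition form3 (u : S -> E -> E -> W) :=
  [/\ forall a s t x y, u (a *: s + t) x y = a *: u s x y + u t x y,
      forall a s x z y, u s (a *: x + z) y = a *: u s x y + u s z y &
      forall a s x y z, u s x (a *: y + z) = a^* *: u s x y + u s x z].

(** For u(s, x, y) = <phi(s) x, y> this is <phi_n(A) x, x> on the n-fold direct sum of the Hilbert
    space. *)
Definition qform (u : S -> E -> E -> W) n (A : 'M[S]_n) (x : 'I_n -> E) : W :=
  \sum_i \sum_j u (A i j) (x j) (x i).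

Variable u : S -> E -> E -> W.
Hypothesis u3 : form3 u.

Lemma form3Dl s t x y : u (s + t) x y = u s x y + u t x y.
Proof. by have [h _ _] := u3; rewrite -[s in LHS]scale1r h scale1r. Qed.

Lemma form3Dm s x z y : u s (x + z) y = u s x y + u s z y.
Proof. by have [_ h _] := u3; rewrite -[x in LHS]scale1r h scale1r. Qed.

Lemma form3Dr s x y z : u s x (y + z) = u s x y + u s x z.
Proof.
by have [_ _ h] := u3; rewrite -[y in LHS]scale1r h conjC1 scale1r.
Qed.

Lemma form30l x y : u 0 x y = 0.
Proof. by apply: (addrI (u 0 x y)); rewrite -form3Dl !addr0. Qed.

Lemma form30m s y : u s 0 y = 0.
Proof. by apply: (addrI (u s 0 y)); rewrite -form3Dm !addr0. Qed.

Lemma form30r s x : u s x 0 = 0.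
Proof. by apply: (addrI (u s x 0)); rewrite -form3Dr !addr0. Qed.

Lemma form3Zl a s x y : u (a *: s) x y = a *: u s x y.
Proof. by have [h _ _] := u3; rewrite -[a *: s]addr0 h form30l addr0. Qed.

Lemma form3Zm a s x y : u s (a *: x) y = a *: u s x y.
Proof. by have [_ h _] := u3; rewrite -[a *: x]addr0 h form30m addr0. Qed.

Lemma form3Zr a s x y : u s x (a *: y) = a^* *: u s x y.
Proof. by have [_ _ h] := u3; rewrite -[a *: y]addr0 h form30r addr0. Qed.

Lemma form3Nm s x y : u s (- x) y = - u s x y.
Proof. by rewrite -scaleN1r form3Zm scaleN1r. Qed.

Lemma form3Nr s x y : u s x (- y) = - u s x y.
Proof. by rewrite -scaleN1r form3Zr rmorphN1 scaleN1r. Qed.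

Lemma form3_suml (I : Type) (r : seq I) (F : I -> S) x y :
  u (\sum_(i <- r) F i) x y = \sum_(i <- r) u (F i) x y.
Proof. by elim/big_rec2: _ => [|i a b _ <-]; rewrite ?form30l ?form3Dl. Qed.

Lemma form3_summ (I : Type) (r : seq I) (F : I -> E) s y :
  u s (\sum_(i <- r) F i) y = \sum_(i <- r) u s (F i) y.
Proof. by elim/big_rec2: _ => [|i a b _ <-]; rewrite ?form30m ?form3Dm. Qed.

Lemma form3_sumr (I : Type) (r : seq I) (F : I -> E) s x :
  u s x (\sum_(i <- r) F i) = \sum_(i <- r) u s x (F i).
Proof. by elim/big_rec2: _ => [|i a b _ <-]; rewrite ?form30r ?form3Dr. Qed.

Lemma qformD n (A B : 'M[S]_n) x : qform u (A + B) x = qform u A x + qform u B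
  x.
Proof.
rewrite /qform -big_split; apply: eq_bigr => i _ /=.
by rewrite -big_split; apply: eq_bigr => j _ /=; rewrite mxE form3Dl.
Qed.

Lemma qformZ n a (A : 'M[S]_n) x :
  qform u (map_mx (fun v => a *: v) A) x = a *: qform u A x.
Proof.
rewrite /qform scaler_sumr; apply: eq_bigr => i _ /=.
by rewrite scaler_sumr; apply: eq_bigr => j _ /=; rewrite mxE form3Zl.
Qed.

Lemma qformN n (A : 'M[S]_n) x : qform u (- A) x = - qform u A x.
Proof.
rewrite -scaleN1r -qformZ; congr qform; apply/matrixP => i j.
by rewrite !mxE scaleN1r.
Qed.

Lemma qformB n (A B : 'M[S]_n) x : qform u (A - B) x = qform u A x - qform u B
  x.
Proof. by rewrite qformD qformN. Qed.

Lemma qform0 n x : qform u (0 : 'M[S]_n) x = 0.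
Proof. by rewrite -(subrr 0) qformB subrr. Qed.

Lemma qform_scalar n s x : qform u (s%:M : 'M[S]_n) x = \sum_i u s (x i) (x i).
Proof.
apply: eq_bigr => i _; rewrite (bigD1 i)//= big1 ?addr0 => [|j ji].
  by rewrite mxE eqxx mulr1n.
by rewrite mxE eq_sym (negPf ji) mulr0n form30l.
Qed.

Lemma qform_compress n m (X : 'M[C]_(n, m)) (A : 'M[S]_n) x :
  qform u (compress X A) x = qform u A (fun k => \sum_i X k i *: x i).
Proof.
transitivity (\sum_i \sum_j \sum_k \sum_l
    ((X k i)^* * X l j) *: u (A k l) (x j) (x i)).
  apply: eq_bigr => i _; apply: eq_bigr => j _; rewrite mxE form3_suml.
  by apply: eq_bigr => k _; rewrite form3_suml; apply: eq_bigr => l _;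
    rewrite form3Zl.
under eq_bigr do rewrite exchange_big.
rewrite exchange_big; apply: eq_bigr => k _ /=.
under [RHS]eq_bigr do rewrite form3_sumr.
rewrite [RHS]exchange_big; apply: eq_bigr => i _ /=.
rewrite exchange_big; apply: eq_bigr => l _ /=.
rewrite form3Zr form3_summ scaler_sumr; apply: eq_bigr => j _.
by rewrite form3Zm scalerA.
Qed.

End Forms.

(** * Compressions of matrices over an operator system *)

Section CompressTheory.
Variables (R : realType) (S : opsystem R).
Local Notation C := R[i].
Local Notation e := (munit S).

Lemma scalar_tens n (v : S) : v%:M = tensmx 1%:M v :> 'M[S]_n.
Proof. by rewrite tensmx_scalar scale1r. Qed.

Lemma compressN n m (X : 'M[C]_(n, m)) (A : 'M[S]_n) :
  compress X (- A) = - compress X A.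
Proof. by apply/eqP; rewrite -addr_eq0 -compressD addNr compress0. Qed.

Lemma compress_id n (A : 'M[S]_n) : compress 1%:M A = A.
Proof.
apply/matrixP => i j; rewrite mxE (bigD1 i)//= (bigD1 j)//= !mxE !eqxx.
rewrite conjC1 mul1r scale1r !big1 ?addr0// => [k ki|k kj].
  by rewrite big1// => l _; rewrite !mxE (negPf ki) conjC0 mul0r scale0r.
by rewrite !mxE (negPf kj) mulr0 scale0r.
Qed.

Lemma sum_tens_delta n (F : 'M[S]_n) :
  F = \sum_p \sum_q tensmx (delta_mx p q) (F p q).
Proof.
apply/matrixP => i j; rewrite summxE (bigD1 i)//= [X in _ + X]big1.
  rewrite addr0 summxE (bigD1 j)//= big1 => [|q /negPf qj].
    by rewrite addr0 !mxE !eqxx scale1r.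
  by rewrite !mxE [j == q]eq_sym qj andbF scale0r.
move=> k /negPf ki; rewrite summxE big1// => q _.
by rewrite !mxE [i == k]eq_sym ki scale0r.
Qed.

Lemma compressM n m p (X : 'M[C]_(n, m)) (Y : 'M[C]_(m, p)) (A : 'M[S]_n) :
  compress Y (compress X A) = compress (X *m Y) A.
Proof.
have cS q r (Z : 'M[C]_(q, r)) (I : finType) (F : I -> 'M[S]_q) :
    compress Z (\sum_i F i) = \sum_i compress Z (F i).
  exact: (big_morph _ (compressD Z) (compress0 _ Z)).
rewrite [A]sum_tens_delta !cS; apply: eq_bigr => i _; rewrite !cS.
apply: eq_bigr => j _; rewrite !compress_tens trmx_mul map_mxM !mulmxA.
by [].
Qed.

End CompressTheory.

Lemma le_addgt0M (R : realType) (a b k : R) : 0 <= k ->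
  (forall d, 0 < d -> a <= b + d * k) -> a <= b.
Proof.
move=> k0 h; apply/ler_addgt0Pr => d d0.
have k1 : 0 < k + 1 by lra.
apply: le_trans (h (d / (k + 1)) _) _; first by rewrite divr_gt0.
by rewrite lerD2l mulrAC ler_pdivrMr//; nra.
Qed.

Lemma ge0_real (R : realType) (x : R[i]) : 0 <= x -> complex.Im x = 0.
Proof. by rewrite lecE => /andP[/eqP]. Qed.

Lemma ge0_limit (R : realType) (k q : R[i]) : 0 <= k ->
  (forall r : R, 0 < r -> 0 <= r%:C * k + q) -> 0 <= q.
Proof.
move=> k0 h; rewrite lecE /=; have {}h r r0 := h r r0.
have Ik : complex.Im k = 0 := ge0_real k0.
have Rk : 0 <= complex.Re k := cRe_le k0.
apply/andP; split.
  have /ge0_real := h 1 ltr01.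
  by case: q k Ik {h k0 Rk} => [a b] [c d] /= ->;
    rewrite mulr0 mul0r !add0r => ->.
apply: (le_addgt0M Rk) => r r0; have /cRe_le := h r r0.
by rewrite cReD cReZ /= addrC.
Qed.

(** * Forms positive at the first level, on the cones of OMAX *)

Section PositiveForms.
Variables (R : realType) (S : opsystem R) (E : lmodType R[i]).
Local Notation C := R[i].
Local Notation e := (munit S).
Variable u : S -> E -> E -> C^o.
Hypotheses (u3 : form3 u) (upos : forall v, pos v -> forall x, 0 <= u v x x).

Lemma qform_unit_ge0 n x : 0 <= qform u (e%:M : 'M[S]_n) x.
Proof.
by rewrite (qform_scalar u3) sumr_ge0// => i _; apply: upos; exact: pos_unit.
Qed.

(** Writing a = P^* P makes a (x) v the compression by [P] of diag(v, ..., v), whose form is a sum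
    of values u(v, y, y). *)
Lemma qform_Dmax n (A : 'M[S]_n) x : Dmax A -> 0 <= qform u A x.
Proof.
move=> [k [a [v [pa pv ->]]]].
rewrite (big_morph _ (fun A B => qformD u3 A B x) (qform0 u3 x)).
apply: sumr_ge0 => i _; have [P ->] := psdmx_gram (pa i).
rewrite -[P ^t Num.conj]mulmx1 -compress_tens -scalar_tens.
rewrite (qform_compress u3) (qform_scalar u3).
by apply: sumr_ge0 => j _; apply: upos.
Qed.

Lemma qform_Cmax n (A : 'M[S]_n) x : Cmax A -> 0 <= qform u A x.
Proof.
move=> CA; apply: (ge0_limit (qform_unit_ge0 x)) => r r0.
have := qform_Dmax x (CA r r0); rewrite (qformD u3).
rewrite (_ : (r%:C *: e)%:M = map_mx (fun v => r%:C *: v) e%:M) ?(qformZ u3)//.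
by apply/matrixP => i j; rewrite !mxE scalerMnr.
Qed.

(** A hermitian matrix is a multiple of the unit minus an element of the OMAX cone, and the form is
    real at both. *)
Lemma qform_real n (A : 'M[S]_n) x : adjmx (@star _ S) A = A ->
  complex.Im (qform u A x) = 0.
Proof.
move=> /Cmax_order[r r0] /(qform_Cmax x)/ge0_real.
rewrite (qformB u3) (_ : (r%:C *: e)%:M = map_mx (fun v => r%:C *: v) e%:M).
  rewrite (qformZ u3); have /ge0_real := qform_unit_ge0 x.
  case: (qform u A x) (qform u e%:M x) => a b [c d] /= ->.
  by rewrite mulr0 mul0r addr0 sub0r => /eqP; rewrite oppr_eq0 => /eqP.
by apply/matrixP => i j; rewrite !mxE scalerMnr.
Qed.

End PositiveForms.

Section OperatorForms.
Variables (R : realType) (S : opsystem R) (H : hilbert R).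
Variable phi : {linear S -> BH H}.

Definition opform (s : S) (x y : H) : R[i]^o := hdot H (phi s x) y.

Lemma opform3 : form3 opform.
Proof.
split=> [a s t x y|a s x z y|a s x y z]; rewrite /opform.
- by rewrite linearP bop_addE bop_scaleE dotDl dotZl.
- by rewrite bop_lin dotDl dotZl.
- by rewrite dotDr dotZr.
Qed.

Lemma qform_opform n (A : 'M[S]_n) (x : 'I_n -> H) :
  \sum_i \sum_j hdot H ((map_mx phi A) i j (x j)) (x i) = qform opform A x.
Proof. by apply: eq_bigr => i _; apply: eq_bigr => j _; rewrite mxE. Qed.

Lemma opform_pos : positive_map phi ->
  forall v, pos v -> forall x, 0 <= opform v x x.
Proof.
move=> pphi v /pphi + x => /(_ (fun=> x)).
by rewrite !big_ord1 mxE eqxx mulr1n.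
Qed.

Lemma opform_unit : unital_map phi ->
  forall x y, opform (munit S) x y = hdot H x y.
Proof. by rewrite /unital_map /opform => ->. Qed.

End OperatorForms.

(** * Matrix norms through two-by-two blocks *)

Definition normblock (R : realType) (V : opsystem R) n (t : R) (A : 'M[V]_n) :
    'M[V]_(n + n) :=
  block_mx (t%:C *: munit V)%:M A (adjmx (@star R V) A) (t%:C *: munit V)%:M.

Section MatrixNorm.
Variables (R : realType) (V : opsystem R).
Local Notation C := R[i].
Local Notation e := (munit V).

Lemma star_real (t : R) (v : V) : star (t%:C *: v) = t%:C *: star v.
Proof. by rewrite starZ cRealJ. Qed.

Lemma adjmxD n (A B : 'M[V]_n) :
  adjmx (@star R V) (A + B) = adjmx (@star R V) A + adjmx (@star R V) B.
Proof. by apply/matrixP => i j; rewrite !mxE starD. Qed.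

Lemma adjmxZ n (a : C) (A : 'M[V]_n) :
  adjmx (@star R V) (map_mx (fun v => a *: v) A) =
  map_mx (fun v => a^* *: v) (adjmx (@star R V) A).
Proof. by apply/matrixP => i j; rewrite !mxE starZ. Qed.

Lemma adjmxN n (A : 'M[V]_n) : adjmx (@star R V) (- A) = - adjmx (@star R V) A.
Proof.
by apply/matrixP => i j; rewrite !mxE -sub0r starB star0 sub0r.
Qed.

Lemma normblock_herm n t (A : 'M[V]_n) :
  adjmx (@star R V) (normblock t A) = normblock t A.
Proof.
rewrite /adjmx /normblock tr_block_mx map_block_mx; congr block_mx.
- apply/matrixP => i j; rewrite !mxE eq_sym; case: eqP => _; last exact: star0.
  by rewrite !mulr1n star_real munit_herm.
- by apply/matrixP => i j; rewrite !mxE starK.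
- apply/matrixP => i j; rewrite !mxE eq_sym; case: eqP => _; last exact: star0.
  by rewrite !mulr1n star_real munit_herm.
Qed.

Lemma normblockD n t s (A : 'M[V]_n) :
  normblock (t + s) A = (s%:C *: e)%:M + normblock t A.
Proof.
have E : (s%:C *: e)%:M = block_mx (s%:C *: e)%:M 0 0 (s%:C *: e)%:M :>
  'M[V]_(n + n).
  exact: scalar_mx_block.
rewrite /normblock E add_block_mx !add0r -!raddfD/= -!scalerDl -!rmorphD.
by rewrite addrC.
Qed.

Lemma mcone_unit n t : 0 <= t -> mcone ((t%:C *: e)%:M : 'M[V]_n).
Proof. by move=> t0; apply: Dmax_cone; exact: Dmax_unit. Qed.

Lemma mnorm_set_nonempty n (A : 'M[V]_n) :
  [set t : R | 0 < t /\ mcone (normblock t A)] !=set0.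
Proof.
have [|r r0 h] := @munit_order _ V _ (- normblock 0 A).
  by rewrite adjmxN normblock_herm.
exists r; split=> //.
by rewrite -[r]add0r normblockD -[normblock _ _]opprK.
Qed.

Lemma mnorm_ge0 n (A : 'M[V]_n) : 0 <= mnorm A.
Proof.
by apply: lb_le_inf; [exact: mnorm_set_nonempty|move=> t [/ltW]].
Qed.

Lemma mnorm_le n (A : 'M[V]_n) t : 0 < t -> mcone (normblock t A) -> mnorm A <=
  t.
Proof. by move=> t0 h; apply: ge_inf; [exists 0 => s [/ltW]|split]. Qed.

(** Raising the diagonal parameter adds a positive multiple of the unit to the block, so the
    admissible parameters are closed upwards. *)
Lemma mnorm_lt n (A : 'M[V]_n) t : mnorm A < t -> mcone (normblock t A).
Proof.
move=> At; have [s [s0 sA] st] : exists2 s,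
    [set t : R | 0 < t /\ mcone (normblock t A)] s & s < t.
  by have [s sP] := inf_lt (mnorm_set_nonempty A) At; exists s.
rewrite -[t](subrK s) addrC normblockD; apply: mconeD => //.
by apply: mcone_unit; rewrite subr_ge0 ltW.
Qed.

End MatrixNorm.

(** * Unital positive maps and the identity into OMAX *)

Section UnitalPositive.
Variables (R : realType) (S T : opsystem R) (phi : {linear S -> T}).
Hypotheses (uphi : unital_map phi) (pphi : positive_map phi).
Local Notation C := R[i].
Local Notation e := (munit S).

Lemma map_scalar n (v : S) : map_mx phi (v%:M : 'M[S]_n) = (phi v)%:M.
Proof. by apply/matrixP => i j; rewrite !mxE raddfMn. Qed.

Lemma map_Dmax n (A : 'M[S]_n) : Dmax A -> Dmax (map_mx phi A).
Proof.
move=> [k [a [v [pa pv ->]]]]; exists k, a, (fun i => phi (v i)); split=> //.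
  by move=> i; exact: pphi.
apply/matrixP => i j; rewrite !mxE !summxE linear_sum; apply: eq_bigr => l _.
by rewrite !mxE linearZ.
Qed.

Lemma map_Cmax n (A : 'M[S]_n) : Cmax A -> mcone (map_mx phi A).
Proof.
move=> CA; apply: Cmax_cone => r r0; have := map_Dmax (CA r r0).
by rewrite raddfD/= map_scalar linearZ/= uphi.
Qed.

(** A hermitian element is a multiple of the unit minus a positive one, so its image is hermitian; a
    general element is a complex combination of two hermitian ones. *)
Lemma phi_star (v : S) : phi (star v) = star (phi v).
Proof.
have herm w : star w = w -> star (phi w) = phi w.
  move=> hw; have [r r0 /pphi/pos_herm] := herm_pos_bound hw.
  rewrite linearB linearZ/= uphi starB starZ cRealJ munit_herm.
  by move=> /addrI/oppr_inj.
have -> : v = (2^-1 : R)%:C *: (v + star v) +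
    ((2^-1 : R)%:C * - 'i%C) *: ('i%C *: (v - star v)).
  rewrite scalerA -mulrA (_ : - 'i%C * 'i%C = 1) ?mulr1.
    rewrite -scalerDr addrACA subrr addr0 scalerDr -scalerDl -rmorphD.
    by rewrite -[LHS]scale1r (_ : 2^-1 + 2^-1 = 1 :> R); last lra.
  by apply/eqP; rewrite eq_complex /=; apply/andP; split; apply/eqP; ring.
set a := _ + star v; set b := _ *: (v - _); set x := _%:C; set y := _ * _.
have ha : star a = a by rewrite /a starD starK addrC.
have hb : star b = b.
  rewrite /b starZ starB starK -opprB scalerN -scaleNr; congr (_ *: _).
  by apply/eqP; rewrite eq_complex /=; apply/andP; split; apply/eqP; ring.
move: ha hb; move: a b x y => a b x y ha hb.
by rewrite starD !starZ ha hb !linearD !linearZ/= starD !starZ !herm.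
Qed.

Lemma map_normblock n t (A : 'M[S]_n) :
  map_mx phi (normblock t A) = normblock t (map_mx phi A).
Proof.
rewrite /normblock map_block_mx !map_scalar linearZ/= uphi.
by congr block_mx; apply/matrixP => i j; rewrite !mxE phi_star.
Qed.

(** As a map on OMAX, [phi] is completely positive; being unital, it carries norm blocks to norm
    blocks. *)
Lemma mnorm_contract n (A : 'M[S]_n) :
  mnorm (map_mx phi A) <= mnorm (map_mx (id_OMAX S) A).
Proof.
apply/ler_addgt0Pr => d d0; set B := map_mx (id_OMAX S) A.
have := @mnorm_lt _ _ _ B (mnorm B + d); rewrite ltrDl => /(_ d0).
have -> : normblock (mnorm B + d) B = normblock (mnorm B + d) A.
  rewrite /normblock; congr block_mx; rewrite /B; apply/matrixP => i j;
    by rewrite !mxE.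
move=> /map_Cmax; rewrite map_normblock; apply: mnorm_le.
by rewrite ltr_wpDl ?mnorm_ge0.
Qed.

Lemma cb_norm_contract : (cb_norm phi <= cb_norm (id_OMAX S))%E.
Proof.
apply: ge_ereal_sup => _ [n _ <-]; apply: ge_ereal_sup => _ [A /= A1 <-].
apply: (@le_trans _ _ (mnorm (map_mx (id_OMAX S) A))%:E).
  by rewrite lee_fin mnorm_contract.
apply: (@le_trans _ _ (amp_norm (id_OMAX S) n)).
  by apply: ereal_sup_ubound; exists A.
by apply: ereal_sup_ubound; exists n.
Qed.

End UnitalPositive.

Section IdentityToOMAX.
Variables (R : realType) (S : opsystem R).
Local Notation e := (munit S).

Lemma id_OMAX_positive : positive_map (id_OMAX S).
Proof.
move=> v pv; apply: Dmax_Cmax.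
have -> : (id_OMAX S v)%:M = tensmx 1%:M v :> 'M[S]_1 by rewrite -scalar_tens.
by apply: Dmax_tens => //; apply: psdmx_scalar.
Qed.

Lemma cb_norm_id_le (c : R) :
  (forall n (A : 'M[S]_n), mnorm A <= 1 -> mnorm (map_mx (id_OMAX S) A) <= c)
    <->
  (cb_norm (id_OMAX S) <= c%:E)%E.
Proof.
split=> [h|h n A A1].
  apply: ge_ereal_sup => _ [n _ <-]; apply: ge_ereal_sup => _ [A /= A1 <-].
  by rewrite lee_fin h.
rewrite -lee_fin; apply: le_trans h.
apply: (@le_trans _ _ (amp_norm (id_OMAX S) n)).
  by apply: ereal_sup_ubound; exists A.
by apply: ereal_sup_ubound; exists n.
Qed.

Lemma cb_norm_id_ge0 : (0 <= cb_norm (id_OMAX S))%E.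
Proof.
(* Level 0 suffices: its only matrix lies in the unit ball and has nonnegative norm. *)
apply: (@le_trans _ _ (amp_norm (id_OMAX S) 0)).
  apply: (@le_trans _ _ (mnorm (map_mx (id_OMAX S) (0 : 'M[S]_0)))%:E).
    by rewrite lee_fin mnorm_ge0.
  apply: ereal_sup_ubound; exists 0 => //=.
  apply: mnorm_le => //.
  rewrite (_ : normblock _ _ = 0); first exact: mcone0.
  by apply/matrixP => -[].
by apply: ereal_sup_ubound; exists 0%N.
Qed.

End IdentityToOMAX.

(** * Wittstock decomposition *)

Section PositiveDefinite.
Variable C : numClosedFieldType.

Lemma posdef_gram n (Q : 'M[C]_n) :
  (forall x : 'rV[C]_n, x != 0 -> 0 < (x *m Q *m x ^t Num.conj) 0 0) ->
  exists2 P : 'M[C]_n, P \in unitmx & Q = P ^t Num.conj *m P.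
Proof.
move=> Q0; have [|P QE] := @psdmx_gram _ _ Q.
  move=> x; have [->|/Q0/ltW//] := eqVneq x 0.
  by rewrite !mul0mx mxE.
exists P => //; rewrite -unitmx_tr -(map_unitmx Num.conj).
rewrite -row_free_unit -kermx_eq0; apply/rowV0P => v /sub_kermxP vP.
apply: contraTeq isT => /Q0; rewrite QE mulmxA vP !mul0mx mxE ltxx.
by [].
Qed.

Lemma psd_shift_gram n (T : 'M[C]_n) (d : C) : psdmx T -> 0 < d ->
  exists2 P : 'M[C]_n, P \in unitmx & T + d%:M = P ^t Num.conj *m P.
Proof.
move=> pT d0; apply: posdef_gram => x x0.
rewrite mulmxDr mulmxDl mxE ltr_wpDl//.
rewrite mul_mx_scalar -scalemxAl mxE mulr_gt0//.
by rewrite -dotmxE (dnorm_gt0 (@dotmx C n)).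
Qed.

End PositiveDefinite.

(** * Block forms and contractions *)

Section BlockForms.
Variables (R : realType) (S E W : lmodType R[i]) (u : S -> E -> E -> W).
Local Notation C := R[i].

Definition crossform m n (A : 'M[S]_(m, n)) (x : 'I_n -> E) (y : 'I_m -> E) : W
  :=
  \sum_i \sum_j u (A i j) (x j) (y i).

Lemma qform_block n m (A : 'M[S]_n) B D (F : 'M[S]_m) (z : 'I_(n + m) -> E) :
  let x i := z (lshift m i) in let y i := z (rshift n i) in
  qform u (block_mx A B D F) z =
  qform u A x + crossform B y x + (crossform D x y + qform u F y).
Proof.
move=> x y; rewrite /qform big_split_ord /=; congr (_ + _).
- rewrite -big_split; apply: eq_bigr => i _; rewrite big_split_ord /=.
  by congr (_ + _); apply: eq_bigr => j _; rewrite ?block_mxEul ?block_mxEur.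
- rewrite -big_split; apply: eq_bigr => i _; rewrite big_split_ord /=.
  by congr (_ + _); apply: eq_bigr => j _; rewrite ?block_mxEdl ?block_mxEdr.
Qed.

Hypothesis u3 : form3 u.

Lemma crossformNl m n (A : 'M[S]_(m, n)) (x : 'I_n -> E) (y : 'I_m -> E) :
  crossform A (fun i => - x i) y = - crossform A x y.
Proof.
rewrite /crossform -sumrN; apply: eq_bigr => i _.
by rewrite -sumrN; apply: eq_bigr => j _; rewrite (form3Nm u3).
Qed.

Lemma crossformNr m n (A : 'M[S]_(m, n)) (x : 'I_n -> E) (y : 'I_m -> E) :
  crossform A x (fun i => - y i) = - crossform A x y.
Proof.
rewrite /crossform -sumrN; apply: eq_bigr => i _.
by rewrite -sumrN; apply: eq_bigr => j _; rewrite (form3Nr u3).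
Qed.

End BlockForms.

Section BlockCones.
Variables (R : realType) (S : opsystem R).
Local Notation C := R[i].
Local Notation e := (munit S).

Lemma compress_entry n m (X : 'M[C]_(n, m)) (A : 'M[S]_n) i j p q a b :
  (forall k, X k i = (k == p)%:R * a) -> (forall k, X k j = (k == q)%:R * b) ->
  compress X A i j = (a^* * b) *: A p q.
Proof.
move=> Xi Xj; rewrite mxE (bigD1 p)//= (bigD1 q)//= Xi Xj !eqxx !mul1r.
rewrite !big1 ?addr0// => [k /negPf kp|l /negPf lq].
  by rewrite big1// => l _; rewrite Xi kp mul0r conjC0 mul0r scale0r.
by rewrite Xj lq mul0r mulr0 scale0r.
Qed.

Lemma compress_row n (a : C) (A : 'M[S]_n) :
  compress (row_mx 1%:M a%:M) A =
  block_mx A (map_mx (fun v => a *: v) A) (map_mx (fun v => a^* *: v) A)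
    (map_mx (fun v => (a^* * a) *: v) A).
Proof.
pose X : 'M[C]_(n, n + n) := row_mx 1%:M a%:M.
have Xl p k : X k (lshift n p) = (k == p)%:R * 1 by rewrite row_mxEl mxE mulr1.
have Xr p k : X k (rshift n p) = (k == p)%:R * a by rewrite row_mxEr mxE
  mulr_natl.
apply/matrixP => i j; case: (split_ordP i) => p ->;
  case: (split_ordP j) => q ->.
- by rewrite (compress_entry _ (Xl p) (Xl q)) conjC1 mulr1 scale1r block_mxEul.
- by rewrite (compress_entry _ (Xl p) (Xr q)) conjC1 mul1r block_mxEur mxE.
- by rewrite (compress_entry _ (Xr p) (Xl q)) mulr1 block_mxEdl mxE.
- by rewrite (compress_entry _ (Xr p) (Xr q)) block_mxEdr mxE.
Qed.

Lemma adjmx_scalar n (v : S) :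
  adjmx (@star _ S) (v%:M : 'M[S]_n) = (star v)%:M.
Proof.
apply/matrixP => i j; rewrite !mxE eq_sym; case: eqP => _; last exact: star0.
by rewrite !mulr1n.
Qed.

(** [X] is hermitian because 1 + X is, and half the sum of (1 1)^* (1 + X) (1 1) and (1 -1)^* (1 -
    X) (1 -1) is the block with diagonal 1 and corners [X]. *)
Lemma contraction_block n (X : 'M[S]_n) :
  mcone (e%:M + X) -> mcone (e%:M - X) -> mcone (normblock 1 X).
Proof.
move=> pX mX; have hX : adjmx (@star _ S) X = X.
  by have := mcone_herm pX; rewrite adjmxD adjmx_scalar munit_herm => /addrI.
have c1 : (-1 : C)^* = -1 by rewrite rmorphN1.
have half0 : 0 <= (2^-1 : R) by rewrite invr_ge0.
have := mconeZ half0 (mconeD (mcone_compress (row_mx 1%:M 1%:M) pX)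
                        (mcone_compress (row_mx 1%:M (-1)%:M) mX)).
rewrite !compress_row add_block_mx map_block_mx.
have half (v : S) : (2^-1 : R)%:C *: (v + v) = v.
  by rewrite scalerDr -scalerDl -rmorphD -[RHS]scale1r (_ : 2^-1 + 2^-1 = 1 :>
    R); last lra.
congr mcone; rewrite /normblock hX; congr block_mx; apply/matrixP => i j;
  rewrite !mxE.
- by rewrite addrACA subrr addr0 half scale1r.
- by rewrite scale1r scaleN1r opprB addrC addrA subrK half.
- by rewrite c1 !conjC1 scale1r scaleN1r opprB addrC addrA subrK half.
- by rewrite c1 !conjC1 mulN1r opprK mul1r !scale1r addrACA subrr addr0 half.
Qed.

End BlockCones.

(** * Forms controlled by the cb-norm of the identity into OMAX *)

Section CbBound.
Variables (R : realType) (S : opsystem R) (E : lmodType R[i]).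
Local Notation C := R[i].
Local Notation e := (munit S).
Variables (u : S -> E -> E -> C^o) (c : R).
Hypotheses (u3 : form3 u) (upos : forall v, pos v -> forall x, 0 <= u v x x).
Hypothesis cb_le : (cb_norm (id_OMAX S) <= c%:E)%E.

Let q n (A : 'M[S]_n) x := complex.Re (qform u A x).

Let qD n (A B : 'M[S]_n) x : q (A + B) x = q A x + q B x.
Proof. by rewrite /q (qformD u3) cReD. Qed.

Let qN n (A : 'M[S]_n) x : q (- A) x = - q A x.
Proof. by rewrite /q (qformN u3) cReN. Qed.

Let qe_ge0 n x : 0 <= q (e%:M : 'M[S]_n) x.
Proof. exact: cRe_le (qform_unit_ge0 u3 upos x). Qed.

Lemma qform_scaled_unit n (t : R) (x : 'I_n -> E) :
  qform u ((t%:C *: e)%:M : 'M[S]_n) x = t%:C * qform u (e%:M : 'M[S]_n) x.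
Proof.
rewrite -[RHS](qformZ u3); congr qform.
by apply/matrixP => i j; rewrite !mxE scalerMnr.
Qed.

Let c_ge0 : 0 <= c.
Proof. by rewrite -lee_fin (le_trans (cb_norm_id_ge0 S)). Qed.

(** From -1 <= X <= 1, [X] is a contraction, so its OMAX norm is at most [c]. The block with
    diagonal c + d is then OMAX-positive, and it is tested on (x, -x). *)
Lemma contraction_form n (X : 'M[S]_n) x :
  mcone (e%:M + X) -> mcone (e%:M - X) -> q X x <= c * q (e%:M : 'M[S]_n) x.
Proof.
move=> pX mX; apply: (le_addgt0M (qe_ge0 x)) => d d0.
have hX : adjmx (@star _ S) X = X.
  by have := mcone_herm pX; rewrite adjmxD adjmx_scalar munit_herm => /addrI.
have X1 : mnorm X <= 1 by apply: mnorm_le => //; exact: contraction_block.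
have /(_ _ _ X1) Xc := (cb_norm_id_le S c).2 cb_le.
have : mnorm (map_mx (id_OMAX S) X) < c + d by apply: le_lt_trans Xc _;
  rewrite ltrDl.
move=> /(@mnorm_lt _ (OMAX S)).
pose z (i : 'I_(n + n)) := match fintype.split i with inl j => x j | inr j => -
  x j end.
have zl : (fun i => z (lshift n i)) = x.
  by apply/funext => i; rewrite /z (unsplitK (inl _)).
have zr : (fun i => z (rshift n i)) = (fun i => - x i).
  by apply/funext => i; rewrite /z (unsplitK (inr _)).
move=> /(@qform_Cmax _ _ _ _ u3 upos _ _ z).
have -> : @normblock R (OMAX S) n (c + d) (map_mx (id_OMAX S) X) =
    block_mx ((c + d)%:C *: e)%:M X X ((c + d)%:C *: e)%:M.
  have -> : map_mx (id_OMAX S) X = X by apply/matrixP => i j; rewrite mxE.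
  by rewrite -[in RHS]hX; congr block_mx; rewrite [RHS]hX.
move=> /cRe_le; rewrite qform_block zl zr /=.
rewrite (crossformNl u3) (crossformNr u3).
have -> : qform u ((c + d)%:C *: e)%:M (fun i => - x i) =
    qform u (((c + d)%:C *: e)%:M : 'M[S]_n) x.
  apply: eq_bigr => i _; apply: eq_bigr => j _.
  by rewrite (form3Nm u3) (form3Nr u3) opprK.
rewrite qform_scaled_unit !(cReD, cReN) !cReZ -/(q _ _) -/(q _ _).
by lra.
Qed.

(** Conjugation by the inverse of an invertible P with P^* P = T + d normalises the sum of the two
    positive matrices to the unit; their difference X then satisfies -1 <= X <= 1. *)
Lemma balanced_form n (T : 'M[C]_n) (A B : 'M[S]_n) x :
  psdmx T -> mcone A -> mcone B -> A + B = tensmx T e ->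
  q A x - q B x <= c * q (tensmx T e) x.
Proof.
move=> pT pA pB AB.
have k0 : 0 <= c * q (e%:M : 'M[S]_n) x by rewrite mulr_ge0.
apply: (le_addgt0M k0) => d d0.
have dC : 0 < d%:C :> C by rewrite ltcR.
have [P Pu PE] := psd_shift_gram pT dC.
(* Sharing [d] equally between [A] and [B] matches the passage from [T] to the invertible T + d and
   leaves A - B unchanged. *)
pose h : 'M[S]_n := ((d / 2)%:C *: e)%:M.
have hc : mcone h by apply: mcone_unit; rewrite divr_ge0// ltW.
have dE : h + h = tensmx (d%:C)%:M e by rewrite tensmx_scalar -unit_half.
pose X := compress (invmx P) (A - B).
have PP : compress (invmx P) (A + h + (B + h)) = e%:M.
  rewrite addrACA AB dE -tensmxDl PE compress_tens.
  have -> : (invmx P) ^t Num.conj *m (P ^t Num.conj *m P) *m invmx P = 1%:M.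
    rewrite mulmxA -map_mxM -trmx_mul mulmxV// trmx1 map_mx1 mul1mx mulmxV//.
  by rewrite tensmx_scalar scale1r.
have ABh : A - B = (A + h) - (B + h) by rewrite opprD addrACA subrr addr0.
have pX : mcone (e%:M + X).
  rewrite -PP -compressD ABh addrACA subrr addr0.
  by apply: mcone_compress; do 2?apply: mconeD.
have mX : mcone (e%:M - X).
  rewrite -PP -compressN -compressD ABh opprB [_ - (A + h)]addrC addrACA subrr
    add0r.
  by apply: mcone_compress; do 2?apply: mconeD.
pose y k := \sum_i P k i *: x i.
have := contraction_form y pX mX.
rewrite /q -!(qform_compress u3) /X compressM mulVmx// compress_id.
rewrite scalar_tens compress_tens mulmx1 -PE tensmxDl.
rewrite -!/(q _ _) !qD qN tensmx_scalar /(q (_)%:M _) qform_scaled_unit cReZ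
  -/(q _ _).
by rewrite -scalar_tens mulrDr [c * (d * _)]mulrCA.
Qed.

End CbBound.

(* [elementary s x y] stands for the tensor [s (x) x (x) y^*] of [S] with the
   finite-rank operators on [H], realised as an [S]-valued kernel on [H]. *)
Section Elementary.
Variables (R : realType) (S : opsystem R) (H : hilbert R).
Local Notation C := R[i].
Local Notation e := (munit S).

Definition elementary (s : S) (x y : H) : H -> H -> S :=
  fun xi eta => (hdot H x xi * hdot H eta y) *: s.

Lemma elementary3 : form3 elementary.
Proof.
split=> [a s t x y|a s x z y|a s x y z]; apply/funext => xi;
  apply/funext => eta;
  rewrite /elementary !fctE.
- by rewrite scalerDr !scalerA [a * _]mulrC.
- by rewrite dotDl dotZl mulrDl scalerDl scalerA -mulrA.
- by rewrite dotDr dotZr mulrDr scalerDl scalerA mulrCA.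
Qed.

Lemma qform_functional (F : (H -> H -> S) -> C) n (A : 'M[S]_n) x :
  (forall a v w, F (a *: v + w) = a * F v + F w) ->
  F (qform elementary A x) = qform (fun s x y => F (elementary s x y) : C^o) A
    x.
Proof.
move=> Flin; have FD v w : F (v + w) = F v + F w.
  by rewrite -[v in LHS]scale1r Flin mul1r.
have F0 : F 0 = 0 by apply: (addrI (F 0)); rewrite -FD !addr0.
rewrite (big_morph F FD F0); apply: eq_bigr => i _.
by rewrite (big_morph F FD F0).
Qed.

Lemma functional_form3 (F : (H -> H -> S) -> C) :
  (forall a v w, F (a *: v + w) = a * F v + F w) ->
  form3 (fun s x y => F (elementary s x y) : C^o).
Proof.
have [l m r] := elementary3.
by move=> Flin; split=> *; rewrite ?l ?m ?r Flin.
Qed.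

Section Gram.
Variables (n : nat) (x : 'I_n -> H).

Definition gram : 'M[C]_n := \matrix_(i, j) hdot H (x i) (x j).

(** The kernel evaluated at the vectors of [x] themselves yields the entries of this compression. *)
Lemma gram_kernel (A : 'M[S]_n) :
  qform elementary A x = 0 -> compress gram A = 0.
Proof.
move=> A0; apply/matrixP => i j; rewrite !mxE.
transitivity (qform elementary A x (x j) (x i)); last by rewrite A0.
rewrite /qform !fct_sumE; apply: eq_bigr => k _; rewrite !fct_sumE.
apply: eq_bigr => l _; rewrite /elementary !mxE mulrC; congr ((_ * _) *: _).
by rewrite [RHS]dotC.
Qed.

(** With G the Gram matrix and Z = 1 - G G^-, the rows of Z annihilate G, so the combinations of the
    [x k] with these coefficients are orthogonal to every [x k] and vanish. Together with
    [gram_kernel] this turns a vanishing tensor into a matrix identity, also for linearly dependent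
    tuples. *)
Lemma gram_factor : exists y : 'I_n -> H, forall k, x k = \sum_i gram k i *: y
  i.
Proof.
pose Y := pinvmx gram; exists (fun i => \sum_j Y i j *: x j) => k.
have -> : \sum_i gram k i *: (\sum_j Y i j *: x j) =
    \sum_j (gram *m Y) k j *: x j.
  under eq_bigr do rewrite scaler_sumr.
  rewrite exchange_big; apply: eq_bigr => j _; rewrite mxE scaler_suml.
  by apply: eq_bigr => i _; rewrite scalerA.
pose Z := 1%:M - gram *m Y.
have ZG : Z *m gram = 0 by rewrite mulmxBl mul1mx mulmxKpV// subrr.
apply/eqP; rewrite -subr_eq0 -dot_eq0; apply/eqP.
have -> : x k - \sum_j (gram *m Y) k j *: x j = \sum_j Z k j *: x j.
  rewrite -[X in X - _](_ : \sum_j (1%:M : 'M[C]_n) k j *: x j = x k).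
    by rewrite -sumrB; apply: eq_bigr => j _;
      rewrite [Z]lock !mxE -lock !mxE scalerBl.
  rewrite (bigD1 k)//= big1 ?addr0 ?mxE ?eqxx ?scale1r// => j jk.
  by rewrite mxE eq_sym (negPf jk) scale0r.
rewrite dot_sumr big1// => j _; rewrite dotZr dot_suml.
have -> : \sum_(i < n) hdot H (Z k i *: x i) (x j) = (Z *m gram) k j.
  by rewrite [RHS]mxE; apply: eq_bigr => i _; rewrite dotZl [gram i j]mxE.
have -> : (Z *m gram) k j = 0 by rewrite ZG mxE.
by rewrite mulr0.
Qed.

End Gram.
End Elementary.

Section CompressMore.
Variables (R : realType) (S : opsystem R).
Local Notation C := R[i].

Lemma compressZ n m (X : 'M[C]_(n, m)) (a : C) (A : 'M[S]_n) :
  compress X (map_mx (fun v => a *: v) A) = map_mx (fun v => a *: v) (compress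
    X A).
Proof.
apply/matrixP => i j; rewrite !mxE scaler_sumr; apply: eq_bigr => k _.
rewrite scaler_sumr; apply: eq_bigr => l _.
by rewrite mxE !scalerA mulrC.
Qed.

Lemma adjmx_compress n m (X : 'M[C]_(n, m)) (A : 'M[S]_n) :
  adjmx (@star _ S) (compress X A) = compress X (adjmx (@star _ S) A).
Proof.
have star_sum (I : finType) (F : I -> S) : star (\sum_i F i) = \sum_i star (F
  i).
  exact: (big_morph _ (@starD _ S) (star0 S)).
apply/matrixP => i j; rewrite !mxE star_sum [RHS]exchange_big.
apply: eq_bigr => k _; rewrite star_sum; apply: eq_bigr => l _.
rewrite !mxE starZ rmorphM /= mulrC; congr ((_ * _) *: _); exact: conjCK.
Qed.

(** One expression for all constraints on the functional F sought, where q is the real part of the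
    given form: an upper bound on F(T (x) e), F(A) >= q(A), F(B) >= - q(B), and, through the factor
    i, the reality of F(D). *)
Definition packed n (T : 'M[C]_n) (A B D : 'M[S]_n) : 'M[S]_n :=
  tensmx T (munit S) - A - B + map_mx (fun v => 'i *: v) D.

Lemma packedD n (T T' : 'M[C]_n) (A A' B B' D D' : 'M[S]_n) :
  packed (T + T') (A + A') (B + B') (D + D') = packed T A B D + packed T' A' B'
    D'.
Proof.
rewrite /packed [RHS]addrACA; congr (_ + _).
  by rewrite [RHS]addrACA [X in _ = X + _]addrACA tensmxDl !opprD.
by apply/matrixP => i j; rewrite !mxE scalerDr.
Qed.

Lemma packed_compress n m (X : 'M[C]_(n, m)) T (A B D : 'M[S]_n) :
  compress X (packed T A B D) =
  packed (X ^t Num.conj *m T *m X) (compress X A) (compress X B) (compress X D).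
Proof. by rewrite /packed !compressD !compressN compress_tens compressZ. Qed.

Lemma packedZ n (a : C) T (A B D : 'M[S]_n) :
  map_mx (fun v => a *: v) (packed T A B D) =
  packed (a *: T) (map_mx (fun v => a *: v) A) (map_mx (fun v => a *: v) B)
    (map_mx (fun v => a *: v) D).
Proof.
apply/matrixP => i j; rewrite !mxE !scalerDr !scalerN !scalerA.
by rewrite ['i * a]mulrC.
Qed.

(** Uniqueness of the splitting into a hermitian and a skew-hermitian part. *)
Lemma herm_part_eq0 n (Y D : 'M[S]_n) :
  adjmx (@star _ S) Y = Y -> adjmx (@star _ S) D = D ->
  Y + map_mx (fun v => 'i *: v) D = 0 -> Y = 0.
Proof.
move=> hY hD P0; apply/matrixP => i j; rewrite [RHS]mxE.
have /matrixP/(_ i j) := P0.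
rewrite [LHS]mxE [X in _ + X]mxE [RHS]mxE => h1.
have /matrixP/(_ j i) := P0.
rewrite [LHS]mxE [X in _ + X]mxE [RHS]mxE => /(congr1 (@star _ S)).
have -> : D j i = star (D i j) by rewrite -[in LHS]hD !mxE.
have -> : Y j i = star (Y i j) by rewrite -[in LHS]hY !mxE.
rewrite starD starZ !starK star0 conjCi scaleNr => /eqP.
rewrite subr_eq0 => /eqP h2; move/eqP: h1; rewrite -h2 -mulr2n -scaler_nat.
by rewrite scaler_eq0 pnatr_eq0 /= => /eqP.
Qed.

Lemma packed_eq0 n T (A B D : 'M[S]_n) : psdmx T -> mcone A -> mcone B ->
  adjmx (@star _ S) D = D -> packed T A B D = 0 -> A + B = tensmx T (munit S).
Proof.
move=> pT pA pB hD /(herm_part_eq0 _ hD) Y0.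
apply/eqP; rewrite eq_sym -subr_eq0 opprD addrA; apply/eqP/Y0.
rewrite !(adjmxD, adjmxN) (mcone_herm pA) (mcone_herm pB).
by rewrite (mcone_herm (psd_tens_cone pT (pos_unit S))).
Qed.

End CompressMore.

(** * The functional dominating a positive form *)

Section DominatingFunctional.
Variables (R : realType) (S : opsystem R) (H : hilbert R).
Local Notation C := R[i].
Local Notation e := (munit S).
Local Notation k := (@elementary R S H).
Variables (u : S -> H -> H -> C^o) (c : R).
Hypotheses (u3 : form3 u) (upos : forall v, pos v -> forall x, 0 <= u v x x).
Hypothesis cb_le : (cb_norm (id_OMAX S) <= c%:E)%E.

Let q n (A : 'M[S]_n) x := complex.Re (qform u A x).

Let cost n (T : 'M[C]_n) (A B : 'M[S]_n) x :=
  c * q (tensmx T e) x - q A x + q B x.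

Let K : set ((H -> H -> S) * R) := [set p | exists n (x : 'I_n -> H) T A B D,
  [/\ psdmx T, mcone A, mcone B, adjmx (@star _ S) D = D &
      p = (qform k (packed T A B D) x, cost T A B x)]].

Let KI n (x : 'I_n -> H) T A B D : psdmx T -> mcone A -> mcone B ->
  adjmx (@star _ S) D = D -> K (qform k (packed T A B D) x, cost T A B x).
Proof. by move=> *; exists n, x, T, A, B, D. Qed.

Let K_add v w s t : K (v, s) -> K (w, t) -> K (v + w, s + t).
Proof.
move=> [n [x [T [A [B [D [pT pA pB hD [-> ->]]]]]]]].
move=> [m [y [T' [A' [B' [D' [pT' pA' pB' hD' [-> ->]]]]]]]].
(* The two tuples are concatenated, and compression by the coordinate projections [X] and [Y] brings
   all matrices to the common size. *)
pose X : 'M[C]_(n, n + m) := row_mx 1%:M 0.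
pose Y : 'M[C]_(m, n + m) := row_mx 0 1%:M.
pose z i := match fintype.split i with inl j => x j | inr j => y j end.
have zX : (fun l => \sum_i X l i *: z i) = x.
  apply/funext => l; rewrite big_split_ord /= [X in _ + X]big1 ?addr0 => [|i _].
    rewrite (bigD1 l)//= big1 ?addr0 => [|i il].
      by rewrite row_mxEl mxE eqxx scale1r /z (unsplitK (inl _)).
    by rewrite row_mxEl mxE eq_sym (negPf il) scale0r.
  by rewrite row_mxEr mxE scale0r.
have zY : (fun l => \sum_i Y l i *: z i) = y.
  apply/funext => l; rewrite big_split_ord /= [X in X + _]big1 ?add0r => [|i _].
    rewrite (bigD1 l)//= big1 ?addr0 => [|i il].
      by rewrite row_mxEr mxE eqxx scale1r /z (unsplitK (inr _)).
    by rewrite row_mxEr mxE eq_sym (negPf il) scale0r.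
  by rewrite row_mxEl mxE scale0r.
have qX (M : 'M[S]_n) : q M x = q (compress X M) z.
  by rewrite /q (qform_compress u3) zX.
have qY (M : 'M[S]_m) : q M y = q (compress Y M) z.
  by rewrite /q (qform_compress u3) zY.
have qD (M N : 'M[S]_(n + m)) : q M z + q N z = q (M + N) z.
  by rewrite /q (qformD u3) cReD.
have -> : qform k (packed T A B D) x + qform k (packed T' A' B' D') y =
    qform k (packed (X ^t Num.conj *m T *m X + Y ^t Num.conj *m T' *m Y)
      (compress X A + compress Y A') (compress X B + compress Y B')
      (compress X D + compress Y D')) z.
  rewrite packedD -!packed_compress (qformD (@elementary3 _ _ _)).
  by rewrite !(qform_compress (@elementary3 _ _ _)) zX zY.
have -> : cost T A B x + cost T' A' B' y =
    cost (X ^t Num.conj *m T *m X + Y ^t Num.conj *m T' *m Y)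
      (compress X A + compress Y A') (compress X B + compress Y B') z.
  rewrite /cost tensmxDl -!compress_tens -!qD -!qX -!qY; ring.
apply: KI.
- by apply: psdmxD; exact: psdmx_congr.
- by apply: mconeD; exact: mcone_compress.
- by apply: mconeD; exact: mcone_compress.
- by rewrite adjmxD !adjmx_compress hD hD'.
Qed.

Let K_scale a v t : 0 < a -> K (v, t) -> K (a%:C *: v, a * t).
Proof.
move=> a0 [n [x [T [A [B [D [pT pA pB hD [-> ->]]]]]]]].
rewrite -(qformZ (@elementary3 _ _ _)) packedZ.
have qZ (M : 'M[S]_n) : q (map_mx (fun v => a%:C *: v) M) x = a * q M x.
  by rewrite /q (qformZ u3) cReZ.
have -> : a * cost T A B x = cost (a%:C *: T) (map_mx (fun v => a%:C *: v) A)
    (map_mx (fun v => a%:C *: v) B) x.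
  rewrite /cost !qZ (_ : tensmx (a%:C *: T) e = map_mx (fun v => a%:C *: v)
    (tensmx T e)).
    by rewrite qZ; ring.
  by apply/matrixP => i j; rewrite !mxE scalerA.
apply: KI.
- by apply: psdmxZ => //; rewrite ler0c ltW.
- by apply: mconeZ => //; exact: ltW.
- by apply: mconeZ => //; exact: ltW.
- by rewrite adjmxZ cRealJ hD.
Qed.

Let K_opp v t : K (v, t) -> exists s, K (- v, s).
Proof.
move=> [n [x [T [A [B [D [pT pA pB hD [-> _]]]]]]]].
have [|r r0 pX] := @munit_order _ S _ (A + B - tensmx T e).
  rewrite !(adjmxD, adjmxN) (mcone_herm pA) (mcone_herm pB).
  by rewrite (mcone_herm (psd_tens_cone pT (pos_unit S))).
(* The opposite tensor comes from r e minus the positive element r e - (A + B - T (x) e), with [D]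
   replaced by its opposite. *)
exists (cost r%:C%:M ((r%:C *: e)%:M - (A + B - tensmx T e)) 0 x).
have -> : - qform k (packed T A B D) x = qform k
    (packed r%:C%:M ((r%:C *: e)%:M - (A + B - tensmx T e)) 0 (- D)) x.
  rewrite -(qformN (@elementary3 _ _ _)); congr qform.
  rewrite /packed tensmx_scalar subr0 subKr opprD !opprB addrA [B + A]addrC.
  congr (_ + _).
  by apply/matrixP => i j; rewrite !mxE scalerN.
apply: KI => //; [|exact: mcone0|by rewrite adjmxN hD].
by apply: psdmx_scalar; rewrite ler0c ltW.
Qed.

(** The heart of consistency: after compression by the Gram matrix, a vanishing tensor gives A + B =
    T (x) e, and [balanced_form] says that the cost is nonnegative. *)
Let K_zero t : K (0, t) -> 0 <= t.
Proof.
move=> [n [x [T [A [B [D [pT pA pB hD [/esym x0 ->]]]]]]]].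
have [y xy] := gram_factor x; have := gram_kernel x0.
set G := gram x; rewrite packed_compress => G0.
have pT' := psdmx_congr G pT; have pA' := mcone_compress G pA.
have pB' := mcone_compress G pB.
have hD' : adjmx (@star _ S) (compress G D) = compress G D.
  by rewrite adjmx_compress hD.
have := balanced_form u3 upos cb_le y pT' pA' pB' (packed_eq0 pT' pA' pB' hD'
  G0).
rewrite -compress_tens !(qform_compress u3).
have -> : (fun l => \sum_i G l i *: y i) = x by apply/funext => l; rewrite -xy.
by rewrite /cost /q; lra.
Qed.

Lemma dominating_functional : exists F : (H -> H -> S) -> C,
  [/\ forall a v w, F (a *: v + w) = a * F v + F w,
    forall n (A : 'M[S]_n) x, mcone A -> `|q A x| <= complex.Re (F (qform k A
      x)),
    forall n (x : 'I_n -> H), complex.Re (F (qform k (e%:M : 'M[S]_n) x)) <=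
      c * q (e%:M : 'M[S]_n) x &
    forall n (D : 'M[S]_n) x, adjmx (@star _ S) D = D ->
      complex.Im (F (qform k D x)) = 0].
Proof.
have psd0 n : psdmx (0 : 'M[C]_n) by move=> y; rewrite mulmx0 mul0mx mxE.
have adj0 n : adjmx (@star _ S) (0 : 'M[S]_n) = 0.
  by apply/matrixP => i j; rewrite !mxE star0.
have tens0 n : tensmx (0 : 'M[C]_n) e = 0 by apply/matrixP => i j;
  rewrite !mxE scale0r.
have map0 n : map_mx (fun v => 'i *: v) (0 : 'M[S]_n) = 0.
  by apply/matrixP => i j; rewrite !mxE scaler0.
have q0 n x : q (0 : 'M[S]_n) x = 0 by rewrite /q (qform0 u3).
have k3 := @elementary3 R S H.
have K00 : K (0, 0).
  exists 0%N, (fun=> 0), 0, 0, 0, 0; split;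
    [exact: psd0|exact: mcone0|exact: mcone0|exact: adj0|].
  by rewrite /cost /packed tens0 map0 !subr0 addr0 (qform0 k3) !q0 mulr0 subr0
    addr0.
have [|F [Flin FK]] := @consistent_complex_functional _ _ K _ K00.
  by split; [exact: K_add|exact: K_scale|exact: K_zero|exact: K_opp].
have F0 : F 0 = 0.
  by apply: (addrI (F 0)); have := Flin 1 0 0;
    rewrite scale1r !addr0 mul1r => <-.
have FN v : F (- v) = - F v.
  by have := Flin (-1) v 0; rewrite addr0 F0 addr0 scaleN1r mulN1r.
have FZ a v : F (a *: v) = a * F v by rewrite -[a *: v]addr0 Flin F0 addr0.
exists F; split=> // [n A x pA|n x|n D x hD].
(* The constraints are now specialised: [A] alone and [B] alone, then T = 1 alone, then [D] and its
   opposite alone. *)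
- have h1 := FK _ _ (KI x (psd0 n) pA (mcone0 S n) (adj0 n)).
  have h2 := FK _ _ (KI x (psd0 n) (mcone0 S n) pA (adj0 n)).
  move: h1 h2; rewrite /cost /packed tens0 map0 !subr0 !addr0 !sub0r (qformN
    k3) FN cReN !q0 mulr0.
  by rewrite ler_norml => h1 h2; apply/andP; split; lra.
- have psd1 : psdmx (1%:M : 'M[C]_n) by exact: psdmx_scalar.
  have := FK _ _ (KI x psd1 (mcone0 S n) (mcone0 S n) (adj0 n)).
  by rewrite /cost /packed tensmx_scalar scale1r map0 !subr0 addr0 !q0 subr0
    addr0.
- have h (D' : 'M[S]_n) : adjmx (@star _ S) D' = D' ->
      - complex.Im (F (qform k D' x)) <= 0.
    move=> hD'; have := FK _ _ (KI x (psd0 n) (mcone0 S n) (mcone0 S n) hD').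
    rewrite /cost /packed tens0 !subr0 add0r !q0 mulr0 subr0 addr0 (qformZ k3)
      FZ.
    by case: (F _) => a b /=; rewrite mul0r mul1r sub0r.
  have := h _ hD; have := h (- D);
    rewrite adjmxN hD (qformN k3) FN => /(_ erefl).
  by case: (F _) => a b /=; lra.
Qed.

End DominatingFunctional.

Section LinearOf.
Variables (R : pzRingType) (V W : lmodType R) (f : V -> W).
Hypothesis f_lin : forall a u v, f (a *: u + v) = a *: f u + f v.

Definition linear_of of (forall a u v, f (a *: u + v) = a *: f u + f v) := f.
HB.instance Definition _ := GRing.isLinear.Build R V W _ (linear_of f_lin)
  f_lin.

Lemma ex_linear : exists g : {linear V -> W}, forall v, g v = f v.
Proof. by exists (linear_of f_lin). Qed.

End LinearOf.

(** Normalising both vectors makes the right-hand side 2K, and rotating x makes the real part attain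
    the modulus of [f]. *)
Lemma sesquilinear_bound (R : realType) (H : hilbert R) (f : H -> H -> R[i]) (K
  : R) :
  (forall a x y, f (a *: x) y = a * f x y) ->
  (forall a x y, f x (a *: y) = a^* * f x y) ->
  (forall x y, - (2 * complex.Re (f x y)) <= K * (hnorm x ^+ 2 + hnorm y ^+ 2))
    ->
  forall x y, `|f x y| <= (K * (hnorm x * hnorm y))%:C.
Proof.
move=> fZl fZr fK x y; have f0l z : f 0 z = 0 by rewrite -(scale0r 0) fZl mul0r.
have f0r z : f z 0 = 0 by rewrite -(scale0r 0) fZr conjC0 mul0r.
have hnorm0 z : (hnorm z == 0) = (z == 0).
  by rewrite -(inj_eq (@complexI _)) -hnormE normr_eq0.
apply: norm_le_rotations => a a1.
have [->|x0] := eqVneq x 0.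
  by rewrite f0l mulr0 /hnorm normr0 !mul0r mulr0.
have [->|y0] := eqVneq y 0.
  by rewrite f0r mulr0 /hnorm normr0 !mulr0.
have x1 : 0 < hnorm x by rewrite lt_def hnorm0 x0 hnorm_ge0.
have y1 : 0 < hnorm y by rewrite lt_def hnorm0 y0 hnorm_ge0.
have na : hnorm (- a *: x) = hnorm x.
  by rewrite /hnorm normrZ normrN a1 mul1r.
have := fK ((hnorm x)^-1%:C *: (- a *: x)) ((hnorm y)^-1%:C *: y).
rewrite !hnormZ na !ger0_norm ?invr_ge0 ?hnorm_ge0// !mulVf ?gt_eqF// !fZl fZr.
rewrite cRealJ [- a * _]mulrCA !cReZ mulNr cReN expr1n.
set r := complex.Re _ => h.
have {}h : (hnorm x)^-1 * (hnorm y)^-1 * r <= K by lra.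
by move: h; rewrite -invfM mulrC ler_pdivrMr ?mulr_gt0.
Qed.

(** * The decomposition of a unital positive map *)

Section Decomposition.
Variables (R : realType) (S : opsystem R) (H : hilbert R).
Local Notation C := R[i].
Local Notation e := (munit S).
Variables (phi : {linear S -> BH H}) (c : R).
Hypotheses (uphi : unital_map phi) (pphi : positive_map phi).
Hypothesis cb_le : (cb_norm (id_OMAX S) <= c%:E)%E.

Let u := opform phi.
Let u3 : form3 u := opform3 phi.
Let upos : forall v, pos v -> forall x, 0 <= u v x x := opform_pos pphi.

(** Read as a form [w], the functional is bounded: positive norm blocks control w(s) by w(e), and
    w(e) is at most [c]. Riesz then makes it an operator-valued map. *)
Lemma dominating_operator : exists psi : {linear S -> BH H},
  [/\ forall n (A : 'M[S]_n) x, mcone A ->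
        complex.Im (qform (opform psi) A x) = 0 /\
        `|complex.Re (qform u A x)| <= complex.Re (qform (opform psi) A x) &
      opnorm (psi e) <= c].
Proof.
have [F [Flin Fq Fe Fim]] := dominating_functional u3 upos cb_le.
pose w : S -> H -> H -> C^o := fun s x y => F (elementary s x y).
have w3 : form3 w := functional_form3 Flin.
have Fw n (A : 'M[S]_n) x : F (qform (@elementary R S H) A x) = qform w A x.
  exact: qform_functional.
have c0 : 0 <= c by rewrite -lee_fin (le_trans (cb_norm_id_ge0 S)).
have we x : complex.Re (w e x x) <= c * hnorm x ^+ 2.
  have := Fe 1%N (fun=> x);
    rewrite Fw !(qform_scalar w3, qform_scalar u3) !big_ord1.
  by rewrite /u opform_unit// hdot_norm.
have block s r x y : qform w (normblock r (s%:M : 'M[S]_1))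
    (fun i => match fintype.split i with inl _ => y | inr _ => x end) =
    r%:C * w e y y + w s x y + (w (star s) y x + r%:C * w e x x).
  rewrite qform_block !(qform_scalar w3) /crossform !big_ord1.
  rewrite (unsplitK (inl _)) (unsplitK (inr _)) adjmx_scalar !mxE eqxx !mulr1n.
  by rewrite !(form3Zl w3).
(* The block with zero diagonal is hermitian, so the functional is real on it. The factor i on [x]
   turns the vanishing imaginary part into an equality of real parts. *)
have wstar s x y : complex.Re (w (star s) y x) = complex.Re (w s x y).
  have := Fim _ _ (fun i => match fintype.split i with inl _ => y | inr _ =>
    'i%C *: x end)
    (normblock_herm 0 (s%:M : 'M[S]_1)).
  rewrite Fw block !mul0r add0r addr0 (form3Zm w3) (form3Zr w3).
  case: (w s x y) (w (star s) y x) => a b [a' b'] /=.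
  by rewrite !(mul0r, mul1r, mulN1r, oppr0, add0r); lra.
have wbound s r : 0 <= r -> mcone (normblock r (s%:M : 'M[S]_1)) ->
    forall x y, `|w s x y| <= (r * c * (hnorm x * hnorm y))%:C.
  move=> r0 pr; apply: sesquilinear_bound => [a x y|a x y|x y].
  - exact: (form3Zm w3).
  - exact: (form3Zr w3).
  - have := Fq _ _ (fun i => match fintype.split i with inl _ => y | inr _ => x
    end) pr.
    rewrite Fw block => /(le_trans (normr_ge0 _)).
    rewrite !cReD !cReZ wstar.
    have h1 := ler_wpM2l r0 (we x); have h2 := ler_wpM2l r0 (we y).
    by lra.
have ex s : exists A : bop H, forall x y, w s x y = hdot H (A x) y.
  have [r [r0 pr]] := mnorm_set_nonempty (s%:M : 'M[S]_1).
  apply: (bounded_form_bop (M := r * c)); first by rewrite mulr_ge0// ltW.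
  - by move=> a x y z; have [_ h _] := w3; apply: h.
  - by move=> a x y z; have [_ _ h] := w3; apply: h.
  - exact: wbound (ltW r0) pr.
have /choice[psi0 psiE] := ex.
have [|psi psiE'] := @ex_linear _ _ (BH H) psi0.
  move=> a s t; apply: bop_ext => x; apply: dot_inj => y.
  rewrite -psiE bop_addE bop_scaleE dotDl dotZl -!psiE.
  by have [h _ _] := w3; apply: h.
have qE n (A : 'M[S]_n) x : qform (opform psi) A x = qform w A x.
  by apply: eq_bigr => i _; apply: eq_bigr => j _; rewrite /opform psiE' -psiE.
exists psi; split=> [n A x pA|].
  rewrite qE -Fw; split; last exact: Fq.
  exact/Fim/mcone_herm.
apply: opnorm_le => // x; rewrite psiE'.
(* For s = e the block with r = 1 is positive, which gives the bound [c] itself. *)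
have /wbound : mcone (normblock 1 (e%:M : 'M[S]_1)).
  apply: contraction_block; first by apply: mconeD; exact: pos_unit.
  by rewrite subrr; exact: mcone0.
move=> /(_ ler01 x (psi0 e x)); rewrite psiE hdotE hnormE mul1r.
rewrite normrX (ger0_norm (_ : 0 <= (hnorm _)%:C)) ?ler0c ?hnorm_ge0//
  -rmorphXn lecR.
have [->|n0] := eqVneq (hnorm (psi0 e x)) 0;
  first by rewrite mulr_ge0 ?hnorm_ge0.
by rewrite expr2 mulrA ler_pM2r// lt_def n0 hnorm_ge0.
Qed.

(** The two maps are (psi + phi)/2 and (psi - phi)/2, with sum psi; psi dominating phi in absolute
    value on every cone is exactly the complete positivity of both. *)
Lemma cp_decomposition_le : exists phi1 phi2 : {linear S -> BH H},
  cp_decomposition phi phi1 phi2 /\ opnorm (phi1 e + phi2 e) <= c.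
Proof.
have [psi [psiq psie]] := dominating_operator.
have [|phi1 phi1E] := @ex_linear _ _ (BH H) (fun v => (2^-1 : C) *: (psi v +
  phi v)).
  move=> a s t; rewrite !linearP !scalerDr !scalerA [a * _]mulrC.
  by rewrite -!addrA; congr (_ + _); rewrite addrCA.
have [|phi2 phi2E] := @ex_linear _ _ (BH H) (fun v => (2^-1 : C) *: (psi v -
  phi v)).
  move=> a s t; rewrite !linearP /= !scalerDr !scalerA [a * _]mulrC.
  by rewrite -!addrA; congr (_ + _); rewrite addrCA.
have halfE (A : BH H) : (2^-1 : C) *: (A + A) = A.
  rewrite scalerDr -scalerDl (_ : 2^-1 + 2^-1 = 1 :> C) ?scale1r//.
  by field.
have half_ge0 : 0 <= (2^-1 : C) by rewrite invr_ge0.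
have uim n (A : 'M[S]_n) x : mcone A -> complex.Im (qform u A x) = 0.
  by move=> pA; apply: (qform_real u3 upos); exact: mcone_herm.
exists phi1, phi2; split; last first.
  by rewrite phi1E phi2E -scalerDr addrACA subrr addr0 halfE.
split.
- move=> n A pA x; rewrite (qform_opform phi1).
  have -> : qform (opform phi1) A x =
      2^-1 * (qform (opform psi) A x + qform u A x).
    rewrite -big_split mulr_sumr; apply: eq_bigr => i _ /=.
    rewrite -big_split mulr_sumr; apply: eq_bigr => j _ /=.
    by rewrite /u /opform phi1E bop_scaleE bop_addE dotZl dotDl.
  rewrite mulr_ge0// lecE /=; have [psiI psiR] := psiq n A x pA.
  move: psiI psiR (uim n A x pA);
    case: (qform _ A x) (qform u A x) => a b [a' b'] /= -> + ->.
  by rewrite addr0 eqxx ler_norml => /andP[h1 h2] /=; lra.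
- move=> n A pA x; rewrite (qform_opform phi2).
  have -> : qform (opform phi2) A x =
      2^-1 * (qform (opform psi) A x - qform u A x).
    rewrite -sumrB mulr_sumr; apply: eq_bigr => i _ /=.
    rewrite -sumrB mulr_sumr; apply: eq_bigr => j _ /=.
    by rewrite /u /opform phi2E bop_scaleE bop_addE bop_oppE dotZl dotDl dotNl.
  rewrite mulr_ge0// lecE /=; have [psiI psiR] := psiq n A x pA.
  move: psiI psiR (uim n A x pA);
    case: (qform _ A x) (qform u A x) => a b [a' b'] /= -> + ->.
  by rewrite subr0 eqxx ler_norml => /andP[h1 h2] /=; lra.
- by move=> v; rewrite phi1E phi2E -scalerBr opprB addrC addrA addrNK halfE.
Qed.

End Decomposition.

(** * Separation from the cones of OMAX *)

Section Separation.
Variables (R : realType) (S : opsystem R) (m : nat) (B : 'M[S]_m).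
Local Notation C := R[i].
Local Notation e := (munit S).
Hypotheses (hB : adjmx (@star _ S) B = B) (nB : ~ Cmax B).

(** Functions of two indices carry the entrywise complex vector space structure on which the
    Hahn-Banach lemma acts. *)
Let entries (A : 'M[S]_m) : 'I_m -> 'I_m -> S := fun i j => A i j.

Let entriesD A A' : entries (A + A') = entries A + entries A'.
Proof. by apply/funext => i; apply/funext => j; rewrite /entries mxE. Qed.

Let entriesZ (a : C) A : entries (map_mx (fun v => a *: v) A) = a *: entries A.
Proof. by apply/funext => i; apply/funext => j; rewrite /entries mxE. Qed.

(** Under the bound l - t r, this expression collects F(e) <= 1, F(d) >= 0, F(B) <= - r and the
    reality of F(D). *)
Let gen (l t : R) (d D : 'M[S]_m) : 'M[S]_m :=
  (l%:C *: e)%:M - d + map_mx (fun v => t%:C *: v) B + map_mx (fun v => 'i *: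
    v) D.

Let genD l l' t t' d d' D D' :
  gen l t d D + gen l' t' d' D' = gen (l + l') (t + t') (d + d') (D + D').
Proof.
apply/matrixP => i j; rewrite !mxE addrACA; congr (_ + _);
  last by rewrite scalerDr.
rewrite addrACA; congr (_ + _); last by rewrite rmorphD scalerDl.
by rewrite addrACA -opprD rmorphD scalerDl mulrnDl.
Qed.

Let genZ (a : R) l t d D : map_mx (fun v => a%:C *: v) (gen l t d D) =
  gen (a * l) (a * t) (map_mx (fun v => a%:C *: v) d) (map_mx (fun v => a%:C *:
    v) D).
Proof.
apply/matrixP => i j;
  rewrite !mxE !scalerDr !scalerN scalerMnr !scalerA -!rmorphM.
by rewrite [a%:C * 'i]mulrC scalerMnr.
Qed.

Lemma separating_functional : exists F : 'M[S]_m -> C,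
  [/\ forall A A', F (A + A') = F A + F A',
      forall a A, F (map_mx (fun v => a *: v) A) = a * F A,
      forall A, Dmax A -> 0 <= F A &
      complex.Re (F B) < 0].
Proof.
have [r r0 nD] : exists2 r : R, 0 < r & ~ Dmax ((r%:C *: e)%:M + B).
  apply: contrapT => h; apply: nB => r r0; apply: contrapT => nD.
  by apply: h; exists r.
pose K : set (('I_m -> 'I_m -> S) * R) := [set p | exists l t d D,
  [/\ 0 <= l, 0 <= t, Dmax d, adjmx (@star _ S) D = D &
      p = (entries (gen l t d D), l - t * r)]].
have adj0 : adjmx (@star _ S) (0 : 'M[S]_m) = 0.
  by apply/matrixP => i j; rewrite !mxE star0.
have scaleN1 (M : 'M[S]_m) : map_mx (fun v => (-1 : C) *: v) M = - M.
  by apply/matrixP => i j; rewrite !mxE scaleN1r.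
have scale0 A : map_mx (fun v => (0 : R)%:C *: v) A = 0 :> 'M[S]_m.
  by apply/matrixP => i j; rewrite !mxE scale0r.
have gen0 : gen 0 0 0 0 = 0.
  by apply/matrixP => i j; rewrite !mxE !scale0r scaler0 mul0rn subr0 !addr0.
have K00 : K (0, 0).
  exists 0, 0, 0, 0; split=> //; first exact: Dmax0.
  by rewrite gen0 mul0r subr0 -[in RHS](scale0 0) entriesZ scale0r.
have hgen l t d : Dmax d -> adjmx (@star _ S)
    ((l%:C *: e)%:M - d + map_mx (fun v => t%:C *: v) B) =
    (l%:C *: e)%:M - d + map_mx (fun v => t%:C *: v) B.
  move=> Dd; rewrite !(adjmxD, adjmxN) adjmxZ hB cRealJ adjmx_scalar star_real
    munit_herm.
  by rewrite (mcone_herm (Dmax_cone Dd)).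
have cK : consistent K.
  split.
  - move=> v w s s' [l [t [d [D [l0 t0 Dd hD [-> ->]]]]]].
    move=> [l' [t' [d' [D' [l0' t0' Dd' hD' [-> ->]]]]]].
    exists (l + l'), (t + t'), (d + d'), (D + D'); split; rewrite ?addr_ge0//.
    + exact: DmaxD.
    + by rewrite adjmxD hD hD'.
    + by rewrite -entriesD genD; congr (_, _); ring.
  - move=> a v s a0 [l [t [d [D [l0 t0 Dd hD [-> ->]]]]]].
    exists (a * l), (a * t), (map_mx (fun v => a%:C *: v) d), (map_mx (fun v =>
      a%:C *: v) D).
    split; rewrite ?mulr_ge0 ?(ltW a0)//.
    + by apply: DmaxZ => //; exact: ltW.
    + by rewrite adjmxZ hD cRealJ.
    + by rewrite -entriesZ genZ; congr (_, _); ring.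
  - move=> s [l [t [d [D [l0 t0 Dd hD [/esym g0 ->]]]]]].
    have {}g0 : gen l t d D = 0.
      by apply/matrixP => i j;
        rewrite [RHS]mxE -[LHS]/(entries (gen l t d D) i j) g0.
    have dE := herm_part_eq0 (hgen l t d Dd) hD g0.
    rewrite leNgt; apply/negP => lt; apply: nD.
    have t1 : 0 < t.
      by rewrite lt_def t0 andbT; apply: contraTneq lt => ->;
        rewrite mul0r subr0 -leNgt.
    (* A negative bound forces t > 0; dividing l e - d + t B = 0 by t then exhibits r e + B as an
       element of [Dmax], against the choice of [r]. *)
    have -> : (r%:C *: e)%:M + B = ((r - t^-1 * l)%:C *: e)%:M +
        map_mx (fun v => t^-1%:C *: v) d.
      have {dE} -> : d = (l%:C *: e)%:M + map_mx (fun v => t%:C *: v) B.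
        by apply/eqP; rewrite eq_sym -subr_eq0 addrAC dE.
      apply/matrixP => i j;
        rewrite !mxE scalerDr !scalerMnr !scalerA -!rmorphM mulVf ?(gt_eqF
          t1)//.
      by rewrite scale1r addrA; congr (_ + _); rewrite -scalerDl -rmorphD subrK.
    apply: DmaxD; last by apply: DmaxZ => //; rewrite invr_ge0.
    apply: Dmax_unit; rewrite subr_ge0 ler_pdivrMl//; lra.
  - move=> v s [l [t [d [D [l0 t0 Dd hD [-> _]]]]]].
    (* The order unit gives membership in [Cmax]; one further unit moves the element into [Dmax]. *)
    have [|q q0 Cq] := @Cmax_order _ S _ (- ((l%:C *: e)%:M - d + map_mx (fun v
      => t%:C *: v) B)).
      by rewrite adjmxN hgen.
    pose d' := ((q + 1)%:C *: e)%:M + ((l%:C *: e)%:M - d + map_mx (fun v =>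
      t%:C *: v) B).
    have Dd' : Dmax d'.
      have := Cq 1 ltr01; rewrite opprK addrA; congr Dmax; congr (_ + _).
      by rewrite -raddfD/= -scalerDl -rmorphD addrC.
    exists ((q + 1) - 0 * r), (q + 1), 0, d', (- D); split=> //.
    + by rewrite addr_ge0// ltW.
    + by rewrite adjmxN hD.
    + congr (_, _); rewrite -scaleN1r -entriesZ scaleN1; congr entries.
      rewrite /gen /d' [in RHS]opprD addrA subrr sub0r [LHS]opprD -[RHS]addrA;
        congr (_ + _).
      by apply/matrixP => i j; rewrite !mxE scale0r add0r scalerN.
have [F [Flin FK]] := consistent_complex_functional cK K00.
have F0 : F 0 = 0.
  by apply: (addrI (F 0)); have := Flin 1 0 0;
    rewrite scale1r !addr0 mul1r => <-.
have FN v : F (- v) = - F v.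
  by have := Flin (-1) v 0; rewrite addr0 F0 addr0 scaleN1r mulN1r.
have entriesN A : entries (- A) = - entries A by rewrite -scaleN1 entriesZ
  scaleN1r.
have scale_i0 : map_mx (fun v => 'i *: v) 0 = 0 :> 'M[S]_m.
  by apply/matrixP => i j; rewrite !mxE scaler0.
have unit0 : ((0 : R)%:C *: e)%:M = 0 :> 'M[S]_m by rewrite scale0r raddf0.
have FZ a v : F (a *: v) = a * F v by rewrite -[a *: v]addr0 Flin F0 addr0.
have Fim D : adjmx (@star _ S) D = D -> complex.Im (F (entries D)) = 0.
  move=> hD; have h D' : adjmx (@star _ S) D' = D' -> - complex.Im (F (entries
    D')) <= 0.
    move=> hD'; have : K (entries (gen 0 0 0 D'), 0 - 0 * r).
      by exists 0, 0, 0, D'; split=> //; exact: Dmax0.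
    rewrite /gen unit0 scale0 subr0 !add0r mul0r oppr0 entriesZ => /FK.
    by rewrite FZ; case: (F _) => a b /=; rewrite mul0r mul1r sub0r.
  have := h _ hD; have := h (- D); rewrite adjmxN hD entriesN FN => /(_ erefl).
  by case: (F _) => a b /=; lra.
exists (F \o entries); split=> /=.
- by move=> A A'; rewrite entriesD -[entries A]scale1r Flin mul1r scale1r.
- by move=> a A; rewrite entriesZ FZ.
- move=> d Dd; rewrite lecE /= Fim ?eqxx /=; last exact/mcone_herm/Dmax_cone.
  have : K (entries (gen 0 0 d 0), 0 - 0 * r) by exists 0, 0, d, 0.
  rewrite /gen unit0 scale0 scale_i0 sub0r !addr0 mul0r subr0 entriesN => /FK.
  by rewrite FN cReN oppr_le0.
- have : K (entries (gen 0 1 0 0), 0 - 1 * r).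
    by exists 0, 1, 0, 0; split=> //; exact: Dmax0.
  rewrite /gen unit0 scale_i0 subr0 add0r addr0 mul1r sub0r entriesZ scale1r =>
    /FK.
  by move/le_lt_trans; apply; rewrite oppr_lt0.
Qed.

End Separation.

(** * Operators on a finite-dimensional space from forms *)

Section FormsOnRows.
Variables (R : realType) (S : lmodType R[i]) (m : nat).
Local Notation C := R[i].
Local Notation E := 'rV[C]_m.
Local Notation H := (euclid_hilbert R m).
Variable u : S -> E -> E -> C^o.
Hypothesis u3 : form3 u.

Lemma form3_delta s (x y : E) :
  u s x y = \sum_i \sum_j x 0 i * (y 0 j)^* * u s (delta_mx 0 i) (delta_mx 0 j).
Proof.
rewrite {1}[x]row_sum_delta (form3_summ u3); apply: eq_bigr => i _.
rewrite {1}[y]row_sum_delta (form3_sumr u3); apply: eq_bigr => j _.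
by rewrite (form3Zm u3) (form3Zr u3) /GRing.scale /= mulrA.
Qed.

Lemma form3_matrix s (x y : E) :
  (x *m (\matrix_(i, j) u s (delta_mx 0 i) (delta_mx 0 j)) *m y ^t Num.conj) 0 0
  = u s x y.
Proof.
rewrite form3_delta exchange_big mxE; apply: eq_bigr => j _ /=.
rewrite !mxE mulr_suml; apply: eq_bigr => i _.
by rewrite !mxE mulrAC.
Qed.

Lemma form3_bounded s : exists2 M : R, 0 <= M &
  forall x y : H, `|u s x y| <= (M * (hnorm x * hnorm y))%:C.
Proof.
pose M : C := \sum_i \sum_j `|u s (delta_mx 0 i) (delta_mx 0 j)|.
have M0 : 0 <= M by apply: sumr_ge0 => i _; apply: sumr_ge0.
exists (complex.Re M) => [|x y]; first exact: (cRe_le M0).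
have -> : (complex.Re M * (hnorm x * hnorm y))%:C = M * (`|x| * `|y|).
  by rewrite !hnormE -{2}(ge0_cRe M0) -!rmorphM.
rewrite form3_delta.
apply: le_trans (ler_norm_sum _ _ _) _; rewrite mulr_suml ler_sum// => i _.
apply: le_trans (ler_norm_sum _ _ _) _; rewrite mulr_suml ler_sum// => j _.
rewrite normrM mulrC ler_wpM2l// normrM norm_conjC.
by apply: ler_pM => //; exact: euclid_coord_le.
Qed.

Lemma form3_operator : exists phi : {linear S -> bop H},
  forall s (x y : H), hdot H (phi s x) y = u s x y.
Proof.
have ex s : exists A : bop H, forall x y : H, u s x y = hdot H (A x) y.
  have [M M0 uM] := form3_bounded s; apply: (bounded_form_bop M0) => //.
  - by move=> a x y z; have [_ h _] := u3; apply: h.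
  - by move=> a x y z; have [_ _ h] := u3; apply: h.
have /choice[psi psiE] := ex.
have [|phi phiE] := @ex_linear _ _ _ psi.
  move=> a s t; apply: bop_ext => x; apply: dot_inj => y.
  rewrite -psiE bop_addE bop_scaleE dotDl dotZl -!psiE.
  by have [h _ _] := u3; apply: h.
by exists phi => s x y; rewrite phiE -psiE.
Qed.

End FormsOnRows.

(** * Unital positive maps into matrices that detect non-positivity in OMAX *)

Section SeparatingMap.
Variables (R : realType) (S : opsystem R) (m : nat).
Local Notation C := R[i].
Local Notation e := (munit S).
Local Notation E := 'rV[C]_m.
Local Notation H := (euclid_hilbert R m).

(** The form u(e) is positive definite, and its invertible Gram factor is a change of basis that
    normalises it to the inner product, which makes the map unital. *)
Lemma unital_positive_of_form (u : S -> E -> E -> C^o) :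
  form3 u -> (forall v, pos v -> forall x, 0 <= u v x x) ->
  (forall x, x != 0 -> 0 < u e x x) ->
  exists (phi : {linear S -> BH H}) (z : E -> H),
  [/\ unital_map phi, positive_map phi &
    forall n (A : 'M[S]_n) (x : 'I_n -> E),
      qform (opform phi) A (z \o x) = qform u A x].
Proof.
move=> u3 upos ue_gt0.
have [|P Pu QP] := @posdef_gram _ _
    (\matrix_(i < m, j < m) u e (delta_mx 0 i) (delta_mx 0 j)).
  by move=> x x0; rewrite form3_matrix// ue_gt0.
have Pu' : P ^t Num.conj \in unitmx by rewrite map_unitmx unitmx_tr.
pose N := invmx (P ^t Num.conj).
pose v s (x y : E) : C^o := u s (x *m N) (y *m N).
have v3 : form3 v.
  split=> [a s t x y|a s x z y|a s x y z]; rewrite /v.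
  - by have [h _ _] := u3; apply: h.
  - by rewrite mulmxDl -scalemxAl; have [_ h _] := u3; apply: h.
  - by rewrite mulmxDl -scalemxAl; have [_ _ h] := u3; apply: h.
have [phi phiE] := form3_operator v3.
exists phi, (fun x => x *m P ^t Num.conj); split.
- apply: bop_ext => x; apply: dot_inj => y; rewrite phiE /v -form3_matrix// QP.
  rewrite euclid_dotE trmx_mul map_mxM !mulmxA mulmxKV// -(mulmxA _ P).
  have -> : P *m N ^t Num.conj = 1%:M.
    by rewrite -[P in LHS]spectral.trmxCK -map_mxM -trmx_mul mulVmx// trmx1
      map_mx1.
  by rewrite mulmx1.
- move=> s ps x; rewrite !big_ord1 mxE eqxx mulr1n phiE; exact: upos.
- move=> n A x; apply: eq_bigr => i _; apply: eq_bigr => j _.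
  by rewrite /opform phiE /v /= !mulmxK.
Qed.

Lemma separating_map (B : 'M[S]_m) :
  adjmx (@star _ S) B = B -> ~ Cmax B ->
  exists phi : {linear S -> BH H}, [/\ unital_map phi, positive_map phi &
    exists x, complex.Re (qform (opform phi) B x) < 0].
Proof.
move=> hB nB; have [F [FD FZ Fpos FB]] := separating_functional hB nB.
have F0 : F 0 = 0 by apply: (addrI (F 0)); rewrite -FD !addr0.
(* A multiple of the unit plus [B] lies in [Dmax] while F(B) is negative, so F is strictly positive
   at the unit. *)
have FeB : 0 < complex.Re (F e%:M).
  have [|r r0 Cr] := @Cmax_order _ S _ (- B); first by rewrite adjmxN hB.
  have /Fpos/cRe_le := Cr 1 ltr01;
    rewrite opprK addrA -raddfD/= -scalerDl -rmorphD.
  have -> : ((1 + r)%:C *: e)%:M = map_mx (fun v => (1 + r)%:C *: v) e%:M :>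
    'M[S]_m.
    by apply/matrixP => i j; rewrite !mxE scalerMnr.
  rewrite FD FZ cReD cReZ /= => h.
  by rewrite -(pmulr_rgt0 _ (_ : 0 < 1 + r)); lra.
pose t := \sum_i complex.Re (F (B i i)%:M).
(* The perturbation below changes the value at [B] by d t, and this [d] keeps that under half of |Re
   F(B)|. *)
have [d d0 dB] : exists2 d : R, 0 < d & complex.Re (F B) + d * t < 0.
  exists (- complex.Re (F B) / (2 * (`|t| + 1))).
    by rewrite divr_gt0 ?oppr_gt0// mulr_gt0// ltr_wpDl.
  have := ler_norm t; have := normr_ge0 t.
  set a := `|t|; set b := complex.Re (F B) => a0 ta.
  have qE : - b / (2 * (a + 1)) * (2 * (a + 1)) = - b.
    by rewrite divfK// gt_eqF// mulr_gt0// ltr_wpDl.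
  have q0 : 0 < - b / (2 * (a + 1)) by rewrite divr_gt0 ?oppr_gt0// mulr_gt0//
    ltr_wpDl.
  set q := - b / _ in qE q0 *; have := ler_wpM2l (ltW q0) ta; nra.
have adjP c (y z : E) : (c *: y + z) ^t Num.conj = c^* *: y ^t Num.conj + z ^t
  Num.conj.
  by rewrite linearP /= map_mxD map_mxZ.
(* The rank-one term is the Choi correspondence between functionals on matrices over [S] and maps
   into matrices; the multiple of the inner product makes u(e) positive definite. *)
pose a (x y : E) : 'M[C]_m :=
  y ^t Num.conj *m x + (d%:C * (x *m y ^t Num.conj) 0 0)%:M.
have entryP c (v w : 'M[C]_1) : (c *: v + w) 0 0 = c * v 0 0 + w 0 0.
  by rewrite [LHS]mxE [X in X + _ = _]mxE.
have aZl c x z y : a (c *: x + z) y = c *: a x y + a z y.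
  rewrite /a mulmxDr mulmxDl -scalemxAr -scalemxAl entryP.
  by rewrite mulrDr mulrCA raddfD /= scalerDr scale_scalar_mx addrACA.
have aZr c x y z : a x (c *: y + z) = c^* *: a x y + a x z.
  rewrite /a adjP mulmxDr mulmxDl -scalemxAr -scalemxAl entryP.
  by rewrite mulrDr mulrCA raddfD /= scalerDr scale_scalar_mx addrACA.
have tZ c (b : 'M[C]_m) (s : S) : tensmx (c *: b) s = map_mx (fun v => c *: v)
  (tensmx b s).
  by apply/matrixP => i j; rewrite !mxE scalerA.
have tZr c (b : 'M[C]_m) (s : S) : tensmx b (c *: s) = map_mx (fun v => c *: v)
  (tensmx b s).
  by rewrite tensmxZ tZ.
pose u (s : S) (x y : E) : C^o := F (tensmx (a x y) s).
have u3 : form3 u.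
  split=> [c s s' x y|c s x z y|c s x y z]; rewrite /u.
  - by rewrite tensmxDr tZr FD FZ.
  - by rewrite aZl tensmxDl tZ FD FZ.
  - by rewrite aZr tensmxDl tZ FD FZ.
have dC : 0 < d%:C :> C by rewrite ltcR.
have apos x : psdmx (a x x).
  apply: psdmxD; first by rewrite -[_ ^t _]mulmx1; apply: psdmx_congr;
    exact: psdmx_scalar.
  by apply: psdmx_scalar;
    rewrite -dotmxE mulr_ge0 ?(ltW dC) ?(dnorm_ge0 (@dotmx C m)).
have [|x x0|phi [z [uphi pphi phiq]]] := unital_positive_of_form u3.
- by move=> v pv x; apply: Fpos; apply: Dmax_tens.
- have -> : u e x x = F (tensmx (x ^t Num.conj *m x) e) +
      d%:C * (x *m x ^t Num.conj) 0 0 * F e%:M.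
    by rewrite /u tensmxDl FD scalar_tens -FZ -tZ scalemx1.
  apply: ltr_wpDl.
    apply/Fpos/Dmax_tens; last exact: pos_unit.
    by rewrite -[_ ^t _]mulmx1; apply: psdmx_congr; exact: psdmx_scalar.
  rewrite !mulr_gt0//; first by rewrite -dotmxE (dnorm_gt0 (@dotmx C m)).
  rewrite ltcE /= FeB andbT ge0_real//.
  by apply: Fpos; rewrite scalar_tens; apply: Dmax_tens;
    [exact: psdmx_scalar|exact: pos_unit].
exists phi; split=> //.
(* On the standard basis the rank-one terms add up to F(B), and the perturbation contributes d times
   a sum with real part [t]. *)
pose x (i : 'I_m) : E := delta_mx 0 i.
exists (z \o x); rewrite phiq.
have -> : qform u B x = F B + d%:C * \sum_i F (B i i)%:M.
  have Fsum (I : finType) (G : I -> 'M[S]_m) : F (\sum_i G i) = \sum_i F (G i).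
    exact: (big_morph F FD F0).
  rewrite [B in F B]sum_tens_delta Fsum mulr_sumr -big_split.
  apply: eq_bigr => i _ /=;
    rewrite Fsum (bigD1 i)//= [in RHS](bigD1 i)//= addrAC.
  have uE j : u (B i j) (x j) (x i) = F (tensmx (delta_mx i j) (B i j)) +
      d%:C * (i == j)%:R * F (B i j)%:M.
    rewrite /u tensmxDl FD trmx_delta map_delta_mx mul_delta_mx.
    rewrite mul_delta_mx_cond scalar_tens -FZ -tZ scalemx1.
    by rewrite eq_sym; case: eqP => _; rewrite ?mulr1n ?mulr0n mxE.
  congr (_ + _); first by rewrite uE eqxx mulr1.
  apply: eq_bigr => j ji.
  by rewrite uE eq_sym (negPf ji) mulr0 mul0r addr0.
by rewrite cReD cReZ cRe_sum.
Qed.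

End SeparatingMap.

(** * Bounding the cb-norm of the identity by decompositions *)

Section CbNormFromDecompositions.
Variables (R : realType) (S : opsystem R).
Local Notation C := R[i].
Local Notation e := (munit S).

Lemma qform_normblock (E : lmodType C) (u : S -> E -> E -> C^o) n r (A :
  'M[S]_n)
    (z : 'I_(n + n) -> E) : form3 u ->
  let x i := z (lshift n i) in let y i := z (rshift n i) in
  qform u (normblock r A) z = r%:C * (\sum_i u e (z i) (z i)) +
    (crossform u A y x + crossform u (adjmx (@star _ S) A) x y).
Proof.
move=> u3 x y; rewrite qform_block !qform_scaled_unit// !(qform_scalar u3).
by rewrite big_split_ord /= mulrDr addrACA addrA [RHS]addrACA -!addrA;
  congr (_ + _); rewrite addrC -!addrA.
Qed.

(** Evaluating [phi1] at [z] and [phi2] at [z] with its second half negated produces the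
    off-diagonal terms of phi1 - phi2, while the diagonal terms add up to s times the form of
    phi1(e) + phi2(e), which [t] bounds. *)
Lemma decomposition_normblock (H : hilbert R) (phi phi1 phi2 : {linear S -> BH
  H})
    n (A : 'M[S]_n) (s t : R) (z : 'I_(n + n) -> H) :
  unital_map phi -> cp_decomposition phi phi1 phi2 ->
  opnorm (phi1 e + phi2 e) <= t -> 0 <= s -> mcone (normblock s A) ->
  0 <= complex.Re (qform (opform phi) (normblock (s * t) A) z).
Proof.
move=> uphi [cp1 cp2 phiE] le_t s0 cA.
pose z' i := match fintype.split i with inl j => z (lshift n j) | inr j => - z
  (rshift n j) end.
have := cp1 _ _ cA z; rewrite (qform_opform phi1) => /cRe_le.
have := cp2 _ _ cA z'; rewrite (qform_opform phi2) => /cRe_le.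
rewrite !qform_normblock; try exact: opform3.
have z'l : (fun i => z' (lshift n i)) = (fun i => z (lshift n i)).
  by apply/funext => i; rewrite /z' (unsplitK (inl _)).
have z'r : (fun i => z' (rshift n i)) = (fun i => - z (rshift n i)).
  by apply/funext => i; rewrite /z' (unsplitK (inr _)).
have p3 := opform3 phi2.
have -> : \sum_i opform phi2 e (z' i) (z' i) = \sum_i opform phi2 e (z i) (z i).
  rewrite !big_split_ord; congr (_ + _); apply: eq_bigr => i _.
    by rewrite [z' _](congr1 (@^~ i) z'l).
  by rewrite [z' _](congr1 (@^~ i) z'r) (form3Nm p3) (form3Nr p3) opprK.
rewrite z'l z'r (crossformNl p3) (crossformNr p3).
have phiB : opform phi = fun v x y => opform phi1 v x y - opform phi2 v x y.
  apply/funext => v; apply/funext => x; apply/funext => y.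
  by rewrite /opform phiE bop_addE bop_oppE dotDl dotNl.
have crossB (M : 'M[S]_n) x y : crossform (opform phi) M x y =
    crossform (opform phi1) M x y - crossform (opform phi2) M x y.
  rewrite phiB /crossform -sumrB; apply: eq_bigr => i _.
  by rewrite -sumrB.
rewrite !crossB.
have -> : \sum_i opform phi e (z i) (z i) = \sum_i hdot H (z i) (z i).
  by apply: eq_bigr => i _; rewrite opform_unit.
have le_sum : complex.Re (\sum_i opform phi1 e (z i) (z i)) +
    complex.Re (\sum_i opform phi2 e (z i) (z i)) <=
    t * complex.Re (\sum_i hdot H (z i) (z i)).
  rewrite -cReD -big_split !cRe_sum mulr_sumr; apply: ler_sum => i _ /=.
  rewrite /opform -dotDl -bop_addE hdot_norm;
    apply: le_trans (hnorm_cauchy _ _) _.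
  rewrite expr2 mulrA ler_wpM2r ?hnorm_ge0//.
  apply: le_trans (opnorm_apply _ _) _.
  by rewrite ler_wpM2r ?hnorm_ge0.
have := ler_wpM2l s0 le_sum; rewrite mulrA.
by rewrite !(cReD, cReN, cReZ) /=; lra.
Qed.

Lemma cb_norm_id_decomposition_le (t : R) : 0 <= t ->
  (forall (H : hilbert R) (phi : {linear S -> BH H}),
    unital_map phi -> positive_map phi -> forall t', t < t' ->
    exists phi1 phi2 : {linear S -> BH H},
      cp_decomposition phi phi1 phi2 /\ opnorm (phi1 e + phi2 e) < t') ->
  (cb_norm (id_OMAX S) <= t%:E)%E.
Proof.
move=> t0 dec; apply/cb_norm_id_le => n A A1; apply/ler_addgt0Pr => d d0.
have td0 : 0 < t + d by lra.
have -> : map_mx (id_OMAX S) A = A by apply/matrixP => i j; rewrite mxE.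
apply: (@mnorm_le _ (OMAX S)) => //.
apply: contrapT => nC.
have [phi [uphi pphi [z]]] := separating_map (normblock_herm (t + d) A) nC.
(* Slack on both sides: t1 > t admits a decomposition, and (t + d)/t1 > 1 makes the block of the
   contraction [A] positive; the product of the two constants is t + d. *)
have [t1 [tt1 t1d]] : exists t1, t < t1 /\ t1 < t + d by exists (t + d / 2);
  split; lra.
have t10 : 0 < t1 by lra.
have [phi1 [phi2 [dphi /ltW le_t1]]] := dec _ _ uphi pphi _ tt1.
have s1 : 1 < (t + d) / t1 by rewrite ltr_pdivlMr ?mul1r.
have cA : mcone (normblock ((t + d) / t1) A).
  by apply: mnorm_lt; exact: le_lt_trans A1 s1.
have := decomposition_normblock z uphi dphi le_t1 (ltW (lt_trans ltr01 s1)) cA.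
by rewrite divfK ?gt_eqF// leNgt => /negP.
Qed.

End CbNormFromDecompositions.

Section ZeroMap.
Variables (R : realType) (S : opsystem R).

(** On the zero space the identity operator is 0, so the zero map is unital. Its presence makes the
    supremum in (iii) nonnegative. *)
Lemma zero_dim_map : exists phi : {linear S -> BH (euclid_hilbert R 0)},
  unital_map phi /\ positive_map phi.
Proof.
have triv (x y : euclid_hilbert R 0) : x = y by apply/(@matrixP _ 1 0) => i [].
have [|phi phiE] := @ex_linear _ _ (BH (euclid_hilbert R 0)) (fun _ : S => 0).
  by move=> a u v; rewrite scaler0 addr0.
exists phi; split.
  by apply: bop_ext => x; exact: triv.
by move=> v _ x; rewrite !big_ord1 phiE mxE eqxx mulr1n bop_zeroE dot0l.
Qed.

End ZeroMap.

(** * Equivalence of the three conditions *)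

Theorem proposition5p4 (R : realType) (S : opsystem R) (C : R) :
  [<->
    (* (i) *)
    completely_bounded (id_OMAX S) /\ cb_norm (id_OMAX S) = C%:E;
    (* (ii) *)
    (forall (T : opsystem R) (phi : {linear S -> T}),
       unital_map phi -> positive_map phi -> completely_bounded phi) /\
    ereal_sup [set x | exists (T : opsystem R) (phi : {linear S -> T}),
      [/\ unital_map phi, positive_map phi & x = cb_norm phi]] = C%:E;
    (* (iii) *)
    (forall (H : hilbert R) (phi : {linear S -> BH H}),
       unital_map phi -> positive_map phi ->
       exists phi1 phi2 : {linear S -> BH H}, cp_decomposition phi phi1 phi2) /\
    C%:E = ereal_sup [set x |
      exists (H : hilbert R) (phi : {linear S -> BH H}),
        [/\ unital_map phi, positive_map phi &
          x = ereal_inf [set y | exists phi1 phi2 : {linear S -> BH H},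
                cp_decomposition phi phi1 phi2 /\
                y = (opnorm (phi1 (munit S) + phi2 (munit S)))%:E]]]
  ].
Proof.
set sup2 := ereal_sup _;
  set inf3 := fun (H : hilbert R) (phi : {linear S -> BH H}) =>
  ereal_inf [set y | exists phi1 phi2 : {linear S -> BH H},
    cp_decomposition phi phi1 phi2 /\
    y = (opnorm (phi1 (munit S) + phi2 (munit S)))%:E].
(* The identity into OMAX is itself one of the maps of (ii), and its cb-norm dominates that of all
   others. *)
have sup2E : sup2 = cb_norm (id_OMAX S).
  apply/eqP; rewrite eq_le; apply/andP; split.
    apply: ge_ereal_sup => _ [T [phi [uphi pphi ->]]]; exact: cb_norm_contract.
  apply: ereal_sup_ubound; exists (OMAX S), (id_OMAX S); split=> //.
  exact: id_OMAX_positive.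
set sup3 := ereal_sup [set x | exists (H : hilbert R) (phi : {linear S -> BH
  H}),
  [/\ unital_map phi, positive_map phi & x = inf3 H phi]].
have sup3_ge0 : (0 <= sup3)%E.
  have [phi [uphi pphi]] := zero_dim_map S.
  apply: (@le_trans _ _ (inf3 _ phi)); last first.
    by apply: ereal_sup_ubound; exists (euclid_hilbert R 0), phi.
  by apply: le_ereal_inf_tmp => _ [phi1 [phi2 [_ ->]]];
    rewrite lee_fin opnorm_ge0.
have sup3_le (c : R) : (cb_norm (id_OMAX S) <= c%:E)%E -> (sup3 <= c%:E)%E.
  move=> cb_le; apply: ge_ereal_sup => _ [H [phi [uphi pphi ->]]].
  have [phi1 [phi2 [dphi le_c]]] := cp_decomposition_le uphi pphi cb_le.
  apply: (@le_trans _ _ (opnorm (phi1 (munit S) + phi2 (munit S)))%:E).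
    by apply: ereal_inf_lbound; exists phi1, phi2.
  by rewrite lee_fin.
have le_sup3 (c : R) : (sup3 <= c%:E)%E -> (cb_norm (id_OMAX S) <= c%:E)%E.
  move=> sup_le; have c0 : 0 <= c by rewrite -lee_fin (le_trans sup3_ge0).
  apply: cb_norm_id_decomposition_le => // H phi uphi pphi t' ct'.
  have : (inf3 H phi < t'%:E)%E.
    apply: (@le_lt_trans _ _ c%:E); last by rewrite lte_fin.
    by apply: le_trans sup_le; apply: ereal_sup_ubound; exists H, phi.
  move=> /ereal_inf_lt[_ [phi1 [phi2 [dphi ->]]]]; rewrite lte_fin.
  by exists phi1, phi2.
have cb_finite (c : R) : cb_norm (id_OMAX S) = c%:E -> sup3 = c%:E.
  move=> cbE; have sc := sup3_le c; rewrite cbE lexx in sc.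
  have {}sc := sc isT; apply/eqP; rewrite eq_le sc /=.
  (* Once finite, the supremum of (iii) can serve as the constant in [le_sup3], which gives the
     reverse inequality. *)
  have fs : sup3 \is a fin_num.
    by rewrite ge0_fin_numE// (le_lt_trans sc)// ltry.
  by rewrite -cbE -(fineK fs) le_sup3// fineK.
tfae.
- move=> [cb cbE]; split; last by rewrite sup2E.
  move=> T phi uphi pphi; apply: le_lt_trans cb; exact: cb_norm_contract.
- move=> [_]; rewrite sup2E => cbE; split; last by rewrite (cb_finite C).
  move=> H phi uphi pphi;
    have cb_le : (cb_norm (id_OMAX S) <= C%:E)%E by rewrite cbE.
  have [phi1 [phi2 [dphi _]]] := cp_decomposition_le uphi pphi cb_le.
  by exists phi1, phi2.
- move=> [_ /esym supE]; have cb_le : (cb_norm (id_OMAX S) <= C%:E)%E.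
    by apply: le_sup3; rewrite supE.
  have fc : cb_norm (id_OMAX S) \is a fin_num.
    by rewrite ge0_fin_numE ?cb_norm_id_ge0// (le_lt_trans cb_le)// ltry.
  split; first by rewrite /completely_bounded (le_lt_trans cb_le)// ltry.
  by rewrite -supE -[LHS](fineK fc); apply/esym/cb_finite; rewrite fineK.
Qed.
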